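(* Let $\mu$ be a weight function on $\mathbb{R}^N$ such that $\mu\ge 0$, $\sqrt{\mu}\in H^1_{loc}(\mathbb{R}^N)$, $\nabla\mu\in L^1_{loc}(\mathbb{R}^N)$ and $\mu^{-1}\in L^1_{loc}(\mathbb{R}^N)$. Suppose there exist constants $k_1,k_2\in\mathbb{R}$, $k_2>2-N$, such that if $$f_\varepsilon=(\varepsilon+|x|^2)^{\frac{\alpha}{2}},\qquad \alpha<0,\quad \varepsilon>0,$$ it holds $$\frac{\nabla f_\varepsilon}{f_\varepsilon}\cdot\nabla\mu=\frac{\alpha x}{\varepsilon+|x|^2}\cdot\nabla\mu\le\left(k_1+\frac{k_2\,\alpha}{\varepsilon+|x|^2}\right)\mu$$ for any $\varepsilon>0$. Then there exists a positive constant $c$ such that $$c\int_{\mathbb{R}^N}\frac{\varphi^2}{|x|^2}\,d\mu\le\int_{\mathbb{R}^N}|\nabla\varphi|^2\,d\mu+k_1\int_{\mathbb{R}^N}\varphi^2\,d\mu$$ for any function $\varphi\in H^1_\mu$, where $c\in(0,c_o(N+k_2)]$ with $c_o(N+k_2)=\left(\frac{N+k_2-2}{2}\right)^2$.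
   Context: Here $d\mu=\mu(x)\,dx$ and $L^2_\mu=L^2(\mathbb{R}^N,\mu(x)\,dx)$. The weighted Sobolev space $H^1_\mu=H^1(\mathbb{R}^N,\mu(x)\,dx)$ is the space of functions in $L^2_\mu$ whose weak (first) derivatives belong to $L^2_\mu$. $\nabla\mu$ is the weak gradient of $\mu$. *)

(* Defs.v *)
From HB Require Import structures.
From mathcomp Require Import all_boot all_order all_algebra.
From mathcomp Require Import ring lra.
From mathcomp Require Import all_classical all_reals all_analysis.
From mathcomp Require Import measurable_realfun.

Set Implicit Arguments.
Unset Strict Implicit.
Unset Printing Implicit Defensive.

Import Order.TTheory GRing.Theory Num.Theory.
Import numFieldNormedType.Exports.

Local Open Scope classical_set_scope.
Local Open Scope ring_scope.

(* R^N is 'rV[R]_N, whose library topology is the usual one.  The library norm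
   on it is the sup norm, so the Euclidean structure is introduced here. *)

Section Euclidean.
Context {R : realType} {N : nat}.
Implicit Types x y : 'rV[R]_N.

Definition dotv x y : R := \sum_(i < N) x ord0 i * y ord0 i.

Definition enorm x : R := Num.sqrt (dotv x x).

Lemma enorm_sqr x : enorm x ^+ 2 = dotv x x.
Proof.
by rewrite sqr_sqrtr// sumr_ge0// => i _; rewrite -expr2 sqr_ge0.
Qed.

End Euclidean.

(* The sigma-algebra on R^N generated by the coordinates, i.e. the Borel one. *)

Definition rV_display : measure_display. Proof. exact: default_measure_display. Qed.

Section MeasurableRV.
Context {R : realType} {n : nat}.

Definition rV_coord (i : 'I_n) (x : 'rV[R]_n) : measurableTypeR R := x ord0 i.

Let rV_set0 : g_sigma_preimage rV_coord set0.
Proof. exact: sigma_algebra0. Qed.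

Let rV_setC A : g_sigma_preimage rV_coord A -> g_sigma_preimage rV_coord (~` A).
Proof. exact: sigma_algebraC. Qed.

Let rV_bigcup (F : _^nat) : (forall i, g_sigma_preimage rV_coord (F i)) ->
  g_sigma_preimage rV_coord (\bigcup_i (F i)).
Proof. exact: sigma_algebra_bigcup. Qed.

HB.instance Definition _ := @isMeasurable.Build rV_display
  'rV[R]_n (g_sigma_preimage rV_coord) rV_set0 rV_setC rV_bigcup.

End MeasurableRV.

Section LebesgueMeasureRV.
Context {R : realType}.

Definition rV_cons n (p : measurableTypeR R * 'rV[R]_n) : 'rV[R]_n.+1 :=
  row_mx (const_mx p.1 : 'M[R]_1) p.2.

Definition rV_uncons n (x : 'rV[R]_n.+1) : measurableTypeR R * 'rV[R]_n :=
  (x ord0 ord0, \row_j x ord0 (lift ord0 j)).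

Lemma rV_consK n : cancel (@rV_cons n) (@rV_uncons n).
Proof.
move=> [a v]; congr (_, _); last apply/rowP => j.
  by rewrite mxE; case: splitP => j //= _; rewrite mxE.
rewrite !mxE; case: splitP => k /=; first by case: k => [[]].
by rewrite /bump/= !add1n => -[] /val_inj ->.
Qed.

Lemma rV_unconsK n : cancel (@rV_uncons n) (@rV_cons n).
Proof.
move=> x; apply/rowP => i; rewrite /rV_cons/= mxE.
case: splitP => j ij; rewrite mxE; congr (x _ _); apply/val_inj => //=.
by rewrite ij; case: j {ij} => [[]].
Qed.

Lemma measurable_rV_coord n (i : 'I_n) :
  measurable_fun [set: 'rV[R]_n] (@rV_coord R n i).
Proof.
move=> _ Y mY; rewrite setTI; apply: sub_sigma_algebra => /=.
rewrite -bigcup_seq/=; exists i => /=; first by rewrite mem_index_enum.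
by exists Y => //; rewrite setTI.
Qed.

Lemma measurable_fun_rVP d (T : measurableType d) n (f : T -> 'rV[R]_n) :
  measurable_fun [set: T] f <->
  forall i, measurable_fun [set: T] (rV_coord i \o f).
Proof.
split=> [mf i|mf].
  exact: (measurableT_comp (@measurable_rV_coord n i)).
have sub : g_sigma_preimage (fun i => rV_coord i \o f) `<=` measurable.
  apply: smallest_sub; first exact: sigma_algebra_measurable.
  case: n => [|n] in f mf *; first by rewrite big_ord0.
  rewrite -bigcup_mkord_ord; apply: bigcup_sub => i Ii.
  by move=> A [B mB <-]; exact: mf.
move: sub; rewrite g_sigma_preimage_comp => sub _ A mA.
by apply: sub; exists A.
Qed.

Lemma measurable_rV_cons n : measurable_fun setT (@rV_cons n).
Proof.
apply/measurable_fun_rVP => i.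
case: (unliftP ord0 i) => [j|] ->.
  rewrite (_ : _ \o _ = rV_coord j \o snd).
    exact: (measurableT_comp (@measurable_rV_coord n j)).
  by apply/funext => p; rewrite -[in RHS](rV_consK p)/= /rV_coord mxE.
rewrite (_ : _ \o _ = fst)//; apply/funext => p.
by rewrite -[in RHS](rV_consK p).
Qed.

Lemma measurable_rV_uncons n : measurable_fun setT (@rV_uncons n).
Proof.
apply/measurable_fun_pairP; split; first exact: (measurable_rV_coord ord0).
apply/measurable_fun_rVP => i.
rewrite (_ : _ \o _ = rV_coord (lift ord0 i)); first exact: measurable_rV_coord.
by apply/funext => x; rewrite /= /rV_coord mxE.
Qed.

Section step.
Variables (n : nat) (m : {sigma_finite_measure set 'rV[R]_n -> \bar R}).

Definition lebesgue_step : set 'rV[R]_n.+1 -> \bar R :=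
  pushforward (@lebesgue_measure R \x m)%E (@rV_cons n).

Let step0 : lebesgue_step set0 = 0%E.
Proof. by rewrite /lebesgue_step /pushforward preimage_set0 measure0. Qed.

Let step_ge0 A : (0 <= lebesgue_step A)%E.
Proof. by rewrite /lebesgue_step /pushforward. Qed.

Let step_sigma_additive : semi_sigma_additive lebesgue_step.
Proof.
move=> F mF tF mUF; rewrite /lebesgue_step /pushforward preimage_bigcup.
apply: measure_semi_sigma_additive.
- by move=> k; rewrite -[X in measurable X]setTI; exact: measurable_rV_cons.
- apply/trivIsetP => /= i j _ _ ij; rewrite -preimage_setI.
  by move/trivIsetP : tF => /(_ _ _ _ _ ij) ->//; rewrite preimage_set0.
- rewrite -preimage_bigcup -[X in measurable X]setTI.
  exact: measurable_rV_cons.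
Qed.

HB.instance Definition _ := isMeasure.Build _ _ _ lebesgue_step
  step0 step_ge0 step_sigma_additive.

Let step_sigma_finite : sigma_finite setT lebesgue_step.
Proof.
have /sigma_finiteP[F [TF ndF Foo]] := sigma_finiteT (@lebesgue_measure R).
have /sigma_finiteP[G [TG ndG Goo]] := sigma_finiteT m.
exists (fun k => @rV_uncons n @^-1` (F k `*` G k)).
  rewrite -preimage_bigcup (_ : \bigcup_k _ = setT) ?preimage_setT//.
  rewrite -setXTT TF TG predeqE => -[x y]; split.
    by move=> [k _ []/= ? ?]; split; exists k.
  move=> [/= [k _ Fx] [l _ Gy]]; exists (maxn k l) => //; split.
  - by move: x Fx; exact/subsetPset/ndF/leq_maxl.
  - by move: y Gy; exact/subsetPset/ndG/leq_maxr.
move=> k; have [mF Fk] := Foo k; have [mG Gk] := Goo k; split.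
  rewrite -[X in measurable X]setTI; apply: measurable_rV_uncons => //.
  exact: measurableX.
rewrite /lebesgue_step /pushforward -comp_preimage.
rewrite (_ : _ \o _ = id) ?preimage_id; last first.
  by apply/funext => p /=; rewrite rV_consK.
by rewrite product_measure1E// lte_mul_pinfty// ge0_fin_numE.
Qed.

HB.instance Definition _ := Measure_isSigmaFinite.Build _ _ _ lebesgue_step
  step_sigma_finite.

End step.

(* Lebesgue measure on R^N, as the image of the product of N copies of the
   one-dimensional Lebesgue measure; see lebesgue_rV_box. *)
Fixpoint lebesgue_rV (n : nat) : {sigma_finite_measure set 'rV[R]_n -> \bar R} :=
  match n with
  | 0 => \d_(0 : 'rV[R]_0)
  | n'.+1 => lebesgue_step (lebesgue_rV n')
  end.

Lemma lebesgue_rV_box n (A : 'I_n -> set (measurableTypeR R)) :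
  (forall i, measurable (A i)) ->
  lebesgue_rV n [set x | forall i, A i (x ord0 i)] =
  (\prod_(i < n) lebesgue_measure (A i))%E.
Proof.
elim: n => [|n ih] in A *.
  move=> _; rewrite big_ord0/= diracE mem_set//.
  by case.
move=> mA; rewrite big_ord_recl -ih//=.
rewrite /lebesgue_step /pushforward.
rewrite (_ : _ @^-1` _ =
  A ord0 `*` [set x : 'rV[R]_n | forall i, A (lift ord0 i) (x ord0 i)]).
  rewrite product_measure1E//.
  rewrite (_ : [set _ | _] = \bigcap_(i in [set: 'I_n])
      rV_coord i @^-1` A (lift ord0 i)); last first.
    by apply/seteqP; split => x /= h i; [move=> _|]; exact: h.
  apply: fin_bigcap_measurable => // i _.
  by rewrite -[X in measurable X]setTI; exact: measurable_rV_coord.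
apply/seteqP; split => p.
  move=> h; split.
    by have := h ord0; rewrite -[in _ -> _](rV_consK p).
  move=> i /=; rewrite -[p](rV_consK p)/= mxE; exact: h.
rewrite -{1}[p](rV_consK p) => -[/= h0 hS] i.
case: (unliftP ord0 i) => [j|] -> //.
by have := hS j; rewrite mxE.
Qed.

End LebesgueMeasureRV.

Section Calculus.
Context {R : realType} {N : nat}.
Implicit Types (f : 'rV[R]_N -> R) (x : 'rV[R]_N).

Definition partial (i : 'I_N) f : 'rV[R]_N -> R := 'D_(delta_mx 0 i) f.

Definition grad f x : 'rV[R]_N := \row_i partial i f x.

Definition smooth f := forall s : seq 'I_N,
  continuous (foldr partial f s) /\
  forall i x, derivable (foldr partial f s) x (delta_mx 0 i).

Definition test_function f :=
  smooth f /\ compact (closure [set x | f x != 0]).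

Definition radial_power (alpha eps : R) x : R :=
  (eps + enorm x ^+ 2) `^ (alpha / 2).

Lemma partial_derive1 i f x :
  partial i f x = derive1 (fun h => f (h *: delta_mx 0 i + x)) 0.
Proof.
rewrite /partial /derive /derive1; congr (lim (_ @ 0^')).
by apply/funext => h /=; rewrite addr0 scale0r add0r.
Qed.

Lemma enorm_sqr_shift (i : 'I_N) x (h : R) :
  enorm (h *: delta_mx 0 i + x) ^+ 2 =
  enorm x ^+ 2 + (h ^+ 2 + (x ord0 i *+ 2) * h).
Proof.
rewrite !enorm_sqr /dotv (bigD1 i)//= [in RHS](bigD1 i)//= !mxE !eqxx mulr1.
rewrite (eq_bigr (fun j => x ord0 j * x ord0 j)).
  by rewrite -[in RHS]addrA (addrC (\sum_(_ < _ | _) _)) !addrA; congr (_ + _); ring.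
by move=> j /negPf ji; rewrite !mxE ji andbF mulr0 add0r.
Qed.

Lemma grad_radial_power (alpha eps : R) x : 0 < eps ->
  (radial_power alpha eps x)^-1 *: grad (radial_power alpha eps) x =
  (alpha / (eps + enorm x ^+ 2)) *: x.
Proof.
move=> eps0; have q0 : 0 < eps + enorm x ^+ 2 by rewrite ltr_wpDr ?sqr_ge0.
apply/rowP => i; rewrite !mxE partial_derive1.
pose g (h : R) := (eps + enorm x ^+ 2) + (h ^+ 2 + (x ord0 i *+ 2) * h).
rewrite (_ : (fun h => _) = (fun y => y `^ (alpha / 2)) \o g).
  have g0 : g 0 = eps + enorm x ^+ 2 by rewrite /g expr0n/= mulr0 !addr0.
  have dg : is_derive (0 : R) (1 : R) g (x ord0 i *+ 2).
    by apply: is_derive_eq; rewrite /GRing.scale/=; ring.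
  have dpow : is_derive (g 0) (1 : R) (fun y => y `^ (alpha / 2))
      (alpha / 2 * (g 0) `^ (alpha / 2 - 1)).
    by have := @is_derive1_powR R (alpha / 2) (g 0); rewrite g0; exact.
  rewrite derive1E; have /@derive_val -> := is_derive1_comp dpow dg.
  rewrite g0 /radial_power powRB ?(gt_eqF q0) ?implybT//.
  rewrite (_ : (eps + enorm x ^+ 2) `^ 1 = eps + enorm x ^+ 2); last first.
    exact/powRr1/ltW.
  rewrite (_ : x ord0 i = x 0 i)//.
  by field; rewrite !gt_eqF// powR_gt0.
by apply/funext => h /=; rewrite /radial_power enorm_sqr_shift addrA.
Qed.

End Calculus.

Section Sobolev.
Context {R : realType} {N : nat}.
Local Notation lambda := (@lebesgue_rV R N).
Implicit Types (u mu : 'rV[R]_N -> R) (Du : 'rV[R]_N -> 'rV[R]_N).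

(* Extended-real valued, so that 1/mu is +oo where mu vanishes. *)
Definition L1loc (f : 'rV[R]_N -> \bar R) :=
  measurable_fun [set: 'rV[R]_N] f /\
  forall K : set 'rV[R]_N, compact K -> lambda.-integrable K f.

Definition L2loc u :=
  measurable_fun [set: 'rV[R]_N] u /\
  forall K : set 'rV[R]_N, compact K ->
    (\int[lambda]_(x in K) (u x ^+ 2)%:E < +oo)%E.

Definition weak_gradient u Du :=
  [/\ L1loc (fun x => (u x)%:E),
      forall i, L1loc (fun x => (Du x ord0 i)%:E) &
      forall i psi, test_function psi ->
        \int[lambda]_x (u x * partial i psi x) =
        - \int[lambda]_x (Du x ord0 i * psi x)].

Definition H1loc u :=
  L2loc u /\
  exists Du, weak_gradient u Du /\ forall i, L2loc (fun x => Du x ord0 i).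

Definition L2_weight mu u :=
  measurable_fun [set: 'rV[R]_N] u /\
  (\int[lambda]_x (u x ^+ 2 * mu x)%:E < +oo)%E.

(* u belongs to H^1_mu and Du is its weak gradient. *)
Definition H1_weight mu u Du :=
  [/\ L2_weight mu u, weak_gradient u Du &
      forall i, L2_weight mu (fun x => Du x ord0 i)].

(* (grad f_eps / f_eps) . Dmu <= (k1 + k2 alpha / (eps + |x|^2)) mu almost
   everywhere, where f_eps = (eps + |x|^2)^(alpha/2); the left-hand side is
   rewritten by grad_radial_power. *)
Definition drift_bound mu Dmu (k1 k2 alpha : R) :=
  forall eps : R, 0 < eps ->
    {ae lambda, forall x : 'rV[R]_N,
      dotv ((radial_power alpha eps x)^-1 *: grad (radial_power alpha eps) x)
           (Dmu x)
      <= (k1 + k2 * alpha / (eps + enorm x ^+ 2)) * mu x}.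

(* The convention 1/0 = 0 at the origin is immaterial: {0} is a null set for
   N > 0. *)
Definition weighted_Hardy mu (k1 c : R) :=
  forall phi Dphi, H1_weight mu phi Dphi ->
    (c%:E * \int[lambda]_x (phi x ^+ 2 / enorm x ^+ 2 * mu x)%:E <=
     \int[lambda]_x (enorm (Dphi x) ^+ 2 * mu x)%:E +
     k1%:E * \int[lambda]_x (phi x ^+ 2 * mu x)%:E)%E.

End Sobolev.

Definition Hardy_const {R : realType} (n : R) : R := ((n - 2) / 2) ^+ 2.

(* Main.v *)
Require Import Defs.
From mathcomp Require Import all_boot all_order all_algebra.
From mathcomp Require Import ring lra.
From mathcomp Require Import all_classical all_reals all_analysis.
From mathcomp Require Import measurable_realfun.

Set Implicit Arguments.
Unset Strict Implicit.
Unset Printing Implicit Defensive.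

Import Order.TTheory GRing.Theory Num.Theory.
Import numFieldNormedType.Exports.

Local Open Scope classical_set_scope.
Local Open Scope ring_scope.

(** The drift bound says that [mu] grows along rays, and Hardy's inequality
    holds for every weight that grows fast enough along rays.

    Let [eps] tend to [+oo] in the drift bound at a point where [mu > 0]: this
    forces [k1 >= 0].  Let [eps] tend to [0]: almost everywhere
      [y . grad mu >= (k2 + k1 |y|^2 / alpha) mu].
    Hence [y . grad mu >= k mu], with [k = k2] on the whole space if [k1 = 0] or
    if the bound holds for all [alpha], and with [k] as close to [k2] as wanted
    on a small ball centred at the origin otherwise.  Integrated along the ray
    through [x] this reads (weight_growth)
      [mu x <= exp (- k s) mu (exp s x)].

    For [phi] in H^1_mu, compare [phi x] with [phi (e x)]:
      [phi (e x) - phi x = int_0^1 (y . grad phi y)_(y = exp s x) ds].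
    Put [b = (N + k) / 2 - 1], which is positive since [k > 2 - N], and
    [t = exp (- b)].  The Cauchy-Schwarz inequality in [s] for the weight
    [exp (- b s)], and [(p - i)^2 <= p^2 / t + i^2 / (1 - t)], bound
    [phi x ^2 / |x|^2] pointwise (hardy_pointwise).  Multiply by [mu], integrate
    over a shell [d <= |x| < p], substitute [y = exp s x] and use the growth of
    [mu].  The integral [A] of [phi^2 / |x|^2 mu] over the shell, a finite
    number, satisfies
      [A <= t (A + p^-2 int phi^2 mu) + (1 - t) b^-2 int |grad phi|^2 mu],
    and absorbing [t A] leaves the constant [b^2] (hardy_shell).  For [k = k2]
    this is the constant [((N + k2 - 2) / 2)^2] of the statement, reached by
    letting [d] tend to [0] and [p] to [+oo] (hardy_global).  For a single [alpha]
    and [k1 > 0], fix a small [p] and estimate [phi^2 / |x|^2] by [phi^2 / p^2] outside the ball of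
    radius [p]; the term [k1 int phi^2 mu] pays for it (hardy_near_origin).

    Both statements along rays come from radial_FTC, a fundamental theorem of
    calculus for functions with a weak gradient.  It is proved by duality:
    against a test function [T], the dilations can be moved onto [T], where they
    are differentiated classically, and
      [d/ds (exp (- (k + N) s) T (exp (- s) y))]
    is, up to sign and factor, [k T + div (z T)] at [z = exp (- s) y], which is
    exactly what the weak gradient pairs with.  Products of functions of one
    coordinate suffice as tests (ae_eq0_of_tensor_tests). *)

(** * Smooth functions of one variable *)

Section SmoothOneVariable.
Context {R : realType}.
Implicit Types f g : R -> R.

Fixpoint times_derivable (n : nat) f : Prop :=
  if n is m.+1
  then (forall x, derivable f x 1) /\ times_derivable m (derive1 f)
  else True.

Definition smooth1 f := forall n, times_derivable n f.

Lemma times_derivableS n f : times_derivable n.+1 f -> times_derivable n f.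
Proof. by elim: n f => // n ih f [df /ih]. Qed.

Lemma derive1_of_is_derive f f' : (forall x, is_derive x (1 : R) f (f' x)) -> derive1 f = f'.
Proof. by move=> df; apply/funext => x; rewrite derive1E; apply: derive_val. Qed.

Lemma times_derivable_is n f f' : (forall x, is_derive x (1 : R) f (f' x)) ->
  times_derivable n f' -> times_derivable n.+1 f.
Proof. by move=> df nf; rewrite /= (derive1_of_is_derive df); split. Qed.

Lemma times_derivable_deriv n f : times_derivable n.+1 f ->
  forall x, is_derive x (1 : R) f (derive1 f x).
Proof. by move=> [df _] x; rewrite derive1E; exact: derivableP. Qed.

Lemma smooth1_derivable f : smooth1 f -> forall x, derivable f x 1.
Proof. by move=> /(_ 1%N)[]. Qed.

Lemma smooth1_deriv f : smooth1 f -> smooth1 (derive1 f).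
Proof. by move=> sf n; have [] := sf n.+1. Qed.

Lemma smooth1_continuous f : smooth1 f -> continuous f.
Proof.
move=> sf x; apply: differentiable_continuous.
exact/derivable1_diffP/smooth1_derivable.
Qed.

Lemma smooth1_is_derive f x : smooth1 f -> is_derive x (1 : R) f (derive1 f x).
Proof. by move=> sf; apply: (times_derivable_deriv (sf 1%N)). Qed.

Lemma times_derivable_cst n (c : R) : times_derivable n (cst c).
Proof.
elim: n c => // n ih c; exact: (@times_derivable_is n _ (cst 0)).
Qed.

Lemma times_derivableD n f g : times_derivable n f -> times_derivable n g ->
  times_derivable n (fun x => f x + g x).
Proof.
elim: n f g => // n ih f g nf ng.
apply: (@times_derivable_is n _ (fun x => derive1 f x + derive1 g x)).
  move=> x; exact: (is_deriveD (times_derivable_deriv nf x) (times_derivable_deriv ng x)).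
by apply: ih; [case: nf|case: ng].
Qed.

Lemma times_derivableM n f g : times_derivable n f -> times_derivable n g ->
  times_derivable n (fun x => f x * g x).
Proof.
elim: n f g => // n ih f g nf ng.
apply: (@times_derivable_is n _ (fun x => f x * derive1 g x + g x * derive1 f x)).
  move=> x; exact: (is_deriveM (times_derivable_deriv nf x) (times_derivable_deriv ng x)).
have [[_ nf'] [_ ng']] := (nf, ng).
by apply: times_derivableD; apply: ih => //; exact: times_derivableS.
Qed.

Lemma times_derivable_affine n f (c d : R) : times_derivable n f ->
  times_derivable n (fun x => f (c * x + d)).
Proof.
elim: n f => // n ih f nf.
apply: (@times_derivable_is n _ (fun x => derive1 f (c * x + d) * c)).
  move=> x; have dg : is_derive x (1 : R) (fun x => c * x + d) c.
    by apply: is_derive_eq; rewrite /GRing.scale/=; ring.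
  have := @is_derive1_comp _ f (fun x => c * x + d) x _ _ (times_derivable_deriv nf _) dg.
  exact.
apply: times_derivableM; last exact: times_derivable_cst.
by apply: ih; case: nf.
Qed.

Lemma smooth1M f g : smooth1 f -> smooth1 g -> smooth1 (fun x => f x * g x).
Proof. by move=> sf sg n; exact: times_derivableM. Qed.

Lemma smooth1_affine f c d : smooth1 f -> smooth1 (fun x => f (c * x + d)).
Proof. by move=> sf n; exact: times_derivable_affine. Qed.

Lemma smooth1_id : smooth1 id.
Proof.
case=> // n; apply: (@times_derivable_is n _ (cst 1)).
exact: times_derivable_cst.
Qed.

(** [exp (- 1 / x) / x ^ k] extended by zero.  Keeping the power [k] makes the
    family stable under differentiation, hence smooth by induction. *)
Definition flat_exp (k : nat) (x : R) : R :=
  if 0 < x then x^-1 ^+ k * expR (- x^-1) else 0.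

Lemma flat_exp_ge0 k x : 0 <= flat_exp k x.
Proof.
by rewrite /flat_exp; case: ifP => // x0; rewrite mulr_ge0// ?expR_ge0// exprn_ge0// invr_ge0 ltW.
Qed.

(** From [u ^ (k + 1) / (k + 1)! <= exp u] at [u = 1 / x]: all the functions of
    the family are O(|x|), and this for [k + 1] is differentiability of the
    [k]-th one at [0]. *)
Lemma flat_exp_le k x : flat_exp k x <= (k.+1)`!%:R * `|x|.
Proof.
rewrite /flat_exp; case: ifPn => [x0|_]; last by rewrite mulr_ge0.
have u0 : 0 < x^-1 by rewrite invr_gt0.
have h : x^-1 ^+ k.+1 <= expR x^-1 * (k.+1)`!%:R.
  rewrite -ler_pdivrMr ?ltr0n ?fact_gt0//.
  by rewrite (le_trans _ (expR_ge1Dxn k (ltW u0)))// lerDr.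
rewrite gtr0_norm// expRN ler_pdivrMr ?expR_gt0// -(ler_pM2r u0) -exprSr.
by rewrite (le_trans h)// le_eqVlt; apply/orP; left; apply/eqP; field; rewrite gt_eqF.
Qed.

Lemma is_derive1_eq f g x d e : is_derive x (1 : R) f d -> f =1 g -> d = e ->
  is_derive x (1 : R) g e.
Proof. by move=> df /funext <- <-. Qed.

Lemma near_is_derive1 f g x d : (\near x, f x = g x) ->
  is_derive x (1 : R) f d -> is_derive x (1 : R) g d.
Proof. by move=> fg df; have := near_eq_is_derive fg df; exact. Qed.

Lemma is_derive_flat_exp k x :
  is_derive x (1 : R) (flat_exp k) (flat_exp k.+2 x - k%:R * flat_exp k.+1 x).
Proof.
have [x0|x0|<-] := ltgtP 0 x.
- have -> : flat_exp k.+2 x - k%:R * flat_exp k.+1 x =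
    x^-1 ^+ k * (expR (- x^-1) * x ^- 2) + expR (- x^-1) * (k%:R * x^-1 ^+ k.-1 * - x ^- 2).
    rewrite /flat_exp x0; case: k => [|k]; first by rewrite !exprS !expr0 !mulr1 !mul0r; field; rewrite gt_eqF.
    by rewrite /= !exprS; field; rewrite gt_eqF.
  apply: (@near_is_derive1 (fun y => y^-1 ^+ k * expR (- y^-1))).
    by near=> y; rewrite /flat_exp ifT//; near: y; exact: lt_nbhsr.
  have dV : is_derive x (1 : R) (fun y : R => y^-1) (- x ^- 2).
    rewrite -[- x ^- 2]mulr1.
    by apply: (@is_deriveV R id x 1 1); rewrite gt_eqF.
  have dX := is_deriveX k dV.
  have dN : is_derive x (1 : R) (fun y : R => - y^-1) (x ^- 2).
    by rewrite -[x ^- 2]opprK; exact: (is_deriveN dV).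
  have dE := @is_derive1_comp _ expR (fun y => - y^-1) x _ _ (is_derive_expR _) dN.
  have dM := is_deriveM dX dE.
  apply: (is_derive1_eq dM) => [y|]; rewrite !fctE//.
- have fx j : flat_exp j x = 0 by rewrite /flat_exp ltNge (ltW x0).
  rewrite !fx mulr0 subr0.
  apply: (@near_is_derive1 (cst 0)).
  near=> y; rewrite /flat_exp ifN// -leNgt ltW//; near: y; exact: lt_nbhsl.
- have fx j : flat_exp j 0 = 0 by rewrite /flat_exp ltxx.
  rewrite !fx mulr0 subr0.
  have lim0 : h^-1 *: (flat_exp k (h *: 1 + 0) - flat_exp k 0) @[h --> 0^'] --> (0 : R).
    have -> : (fun h : R => h^-1 *: (flat_exp k (h *: 1 + 0) - flat_exp k 0)) =
        flat_exp k.+1.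
      apply/funext => h; rewrite addr0 [in flat_exp k 0]/flat_exp ltxx subr0.
      rewrite /flat_exp /GRing.scale/= mulr1; case: ifP => _; last by rewrite mulr0.
      by rewrite exprS mulrA.
    apply: (@squeeze_cvgr _ _ _ _ (cst 0) (fun h => (k.+2)`!%:R * `|h|)).
    - by near=> h; rewrite flat_exp_ge0 flat_exp_le.
    - exact: cvg_cst.
    - rewrite -[X in _ --> X](mulr0 (k.+2)`!%:R); apply: cvgMr.
      by rewrite -[X in _ --> X](@normr0 _ R); apply: cvg_norm; exact: nbhs_dnbhs.
  by apply: DeriveDef; [exact: cvgP lim0|exact/cvg_lim].
Unshelve. all: by end_near. Qed.

Lemma smooth1_flat_exp k : smooth1 (flat_exp k).
Proof.
move=> n; elim: n k => // n ih k.
apply: (@times_derivable_is n _ (fun x => flat_exp k.+2 x + (- k%:R) * flat_exp k.+1 x)).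
  by move=> x; rewrite mulNr; exact: is_derive_flat_exp.
apply: times_derivableD => //; apply: times_derivableM => //.
exact: times_derivable_cst.
Qed.

(** Both factors tend to 1 where their argument is positive, so that these
    functions increase to the indicator of [`]a, b[]. *)
Definition bump (a b : R) (n : nat) (x : R) : R :=
  flat_exp 0 (n.+1%:R * (x - a)) * flat_exp 0 (n.+1%:R * (b - x)).

Lemma flat_exp0_le1 x : flat_exp 0 x <= 1.
Proof.
rewrite /flat_exp; case: ifP => // x0.
by rewrite expr0 mul1r -expR0 ler_expR oppr_le0 invr_ge0 ltW.
Qed.

Lemma smooth1_bump a b n : smooth1 (bump a b n).
Proof.
have -> : bump a b n = fun x => flat_exp 0 (n.+1%:R * x + - (n.+1%:R * a)) *
    flat_exp 0 (- n.+1%:R * x + n.+1%:R * b).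
  by apply/funext => x; rewrite /bump !mulrBr mulNr (addrC (- _)).
by apply: smooth1M; apply: smooth1_affine; exact: smooth1_flat_exp.
Qed.

Lemma bump_ge0 a b n x : 0 <= bump a b n x.
Proof. by rewrite mulr_ge0 ?flat_exp_ge0. Qed.

Lemma bump_le1 a b n x : bump a b n x <= 1.
Proof. by rewrite mulr_ile1 ?flat_exp_ge0 ?flat_exp0_le1. Qed.

Lemma bump_out a b n x : ~~ (a < x < b) -> bump a b n x = 0.
Proof.
rewrite negb_and -!leNgt /bump /flat_exp => /orP[h|h].
  by rewrite ifN ?mul0r// -leNgt pmulr_rle0// subr_le0.
by rewrite [X in _ * X]ifN ?mulr0// -leNgt pmulr_rle0// subr_le0.
Qed.

Lemma flat_exp0_cvg (x : R) : 0 < x ->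
  flat_exp 0 (n.+1%:R * x) @[n --> \oo] --> (1 : R).
Proof.
move=> x0.
have -> : (fun n => flat_exp 0 (n.+1%:R * x)) = (fun n => expR (- (n.+1%:R^-1 * x^-1))).
  by apply/funext => n; rewrite /flat_exp mulr_gt0// expr0 mul1r invfM.
rewrite -[X in _ --> X]expR0; apply: continuous_cvg; first exact: continuous_expR.
rewrite -[X in _ --> X]oppr0; apply: cvgN; rewrite -[X in _ --> X](mul0r x^-1); apply: cvgMl.
exact: cvg_harmonic.
Qed.

Lemma bump_cvg a b x : bump a b n x @[n --> \oo] --> ((\1_`]a, b[ : R -> R) x).
Proof.
rewrite indicE mem_setE in_itv/=; case: (boolP (a < x < b)) => [/andP[ax xb]|nx].
  rewrite -[X in _ --> X](mulr1 1).
  by apply: cvgM; apply: flat_exp0_cvg; rewrite subr_gt0.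
by under eq_cvg do rewrite bump_out//; exact: cvg_cst.
Qed.

End SmoothOneVariable.

(** * Test functions that are products of functions of one coordinate *)

Section TensorProducts.
Context {R : realType} {N : nat}.
Implicit Types (th : 'I_N -> R -> R) (x : 'rV[R]_N).

Definition tensor th x : R := \prod_(j < N) th j (x ord0 j).

Definition deriv_at (i : 'I_N) th (j : 'I_N) : R -> R :=
  if j == i then derive1 (th j) else th j.

Lemma tensor_shift i th x h : tensor th (h *: delta_mx 0 i + x) =
  th i (h + x ord0 i) * \prod_(j < N | j != i) th j (x ord0 j).
Proof.
rewrite /tensor (bigD1 i)//= !mxE !eqxx mulr1; congr (_ * _).
by apply: eq_bigr => j /negPf ji; rewrite !mxE ji andbF mulr0 add0r.
Qed.

Lemma is_derive_tensor_shift i th x : smooth1 (th i) ->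
  is_derive (0 : R) (1 : R) (fun h => tensor th (h *: delta_mx 0 i + x))
    (tensor (deriv_at i th) x).
Proof.
move=> si; set C := \prod_(j < N | j != i) th j (x ord0 j).
have ds : is_derive (0 : R) (1 : R) (fun h => h + x ord0 i) 1.
  by apply: is_derive_eq; rewrite addr0.
have dth : is_derive (0 + x ord0 i) (1 : R) (th i) (derive1 (th i) (x ord0 i)).
  by rewrite add0r; exact: smooth1_is_derive.
have dc := @is_derive1_comp _ (th i) (fun h => h + x ord0 i) 0 _ _ dth ds.
have dM := is_deriveM dc (is_derive_cst C (0 : R) (1 : R)).
apply: (is_derive1_eq dM) => [h|].
  by rewrite tensor_shift.
rewrite scaler0 add0r /tensor (bigD1 i)//= /deriv_at eqxx mulr1.
rewrite /GRing.scale/= mulrC; congr (_ * _).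
by apply: eq_bigr => j /negPf ->.
Qed.

Lemma derivable_tensor i th x : smooth1 (th i) ->
  derivable (tensor th) x (delta_mx 0 i).
Proof.
move=> si; apply/derivable1P.
by have := @is_derive_tensor_shift i th x si => -[].
Qed.

Lemma partial_tensor i th : smooth1 (th i) ->
  partial i (tensor th) = tensor (deriv_at i th).
Proof.
move=> si; apply/funext => x; rewrite partial_derive1 derive1E.
by have := @is_derive_tensor_shift i th x si => /@derive_val.
Qed.

Lemma smooth1_deriv_at i th : (forall j, smooth1 (th j)) ->
  forall j, smooth1 (deriv_at i th j).
Proof.
by move=> sth j; rewrite /deriv_at; case: ifP => _ //; exact: smooth1_deriv.
Qed.

Lemma continuous_tensor th : (forall j, continuous (th j)) ->
  continuous (tensor th).
Proof.
move=> cth; rewrite /tensor; apply: continuous_big => [|j _ x].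
  exact: mul_continuous.
apply: (@continuous_comp _ _ _ (fun x : 'rV[R]_N => x ord0 j) (th j)).
  exact: coord_continuous.
exact: cth.
Qed.

Lemma smooth_tensor th : (forall j, smooth1 (th j)) -> smooth (tensor th).
Proof.
move=> sth s.
have [th' [sth' ->]] : exists th', (forall j, smooth1 (th' j)) /\
    foldr partial (tensor th) s = tensor th'.
  elim: s => [|i s [th' [sth' E]]]; first by exists th.
  exists (deriv_at i th'); split; first exact: smooth1_deriv_at.
  by rewrite /= E partial_tensor.
split; last by move=> i x; exact: derivable_tensor.
by apply: continuous_tensor => j; exact: smooth1_continuous.
Qed.

Lemma test_function_tensor th M : (forall j, smooth1 (th j)) ->
  (forall j t, M < `|t| -> th j t = 0) -> test_function (tensor th).
Proof.
move=> sth th0; split; first exact: smooth_tensor.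
pose K := [set x : 'rV[R]_N | forall i, `[- M, M]%classic (x ord0 i)].
have cK : compact K.
  by apply: (@rV_compact R N (fun=> `[- M, M]%classic)) => i; exact: segment_compact.
apply: (subclosed_compact (@closed_closure _ _) cK).
have /closure_id -> : closed K.
  by apply: compact_closed => //; exact: norm_hausdorff.
apply: closureS => y /= ty i; rewrite /= in_itv/= -ler_norml leNgt.
apply/negP => /th0 h.
by move: ty; rewrite /tensor (bigD1 i)//= h mul0r eqxx.
Qed.

End TensorProducts.

(** * Boxes and the Borel sets of R^N *)

Section Boxes.
Context {R : realType} {N : nat}.
Implicit Types (x : 'rV[R]_N) (a b : 'I_N -> R).
Local Notation lambda := (@lebesgue_rV R N).

Definition box a b : set 'rV[R]_N :=
  [set x | forall i, `]a i, b i[%classic (x ord0 i)].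

Definition cube (k : nat) : set 'rV[R]_N := box (fun=> - k%:R) (fun=> k%:R).

Definition boxes : set (set 'rV[R]_N) := [set A | exists a b, A = box a b].

Lemma measurable_box a b : measurable (box a b).
Proof.
rewrite (_ : box a b = \bigcap_(i in [set: 'I_N]) rV_coord i @^-1` `]a i, b i[); last first.
  by apply/seteqP; split => x /= h i; [move=> _|]; exact: h.
apply: fin_bigcap_measurable => // i _.
by rewrite -[X in measurable X]setTI; exact: measurable_rV_coord.
Qed.

Lemma measurable_cube k : measurable (cube k).
Proof. exact: measurable_box. Qed.

Lemma lebesgue_box a b : (forall i, a i <= b i) ->
  lambda (box a b) = (\prod_(i < N) (b i - a i))%:E.
Proof.
move=> ab; rewrite (@lebesgue_rV_box R N (fun i => `]a i, b i[%classic))// -prodEFin; apply: eq_bigr => i _.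
rewrite lebesgue_measure_itv/= lte_fin; case: ifPn => //.
by rewrite -leNgt => ba; rewrite (@le_anti _ _ (b i) (a i)) ?ba ?ab// subrr.
Qed.

Lemma box_setI a b a' b' : box a b `&` box a' b' =
  box (fun i => Num.max (a i) (a' i)) (fun i => Num.min (b i) (b' i)).
Proof.
apply/seteqP; split => x /=.
  move=> [h h'] i; have := h i; have := h' i; rewrite /= !in_itv/=.
  by rewrite gt_max lt_min => /andP[h1 h2] /andP[h3 h4]; rewrite h1 h2 h3 h4.
move=> h; split=> i; have := h i; rewrite /= !in_itv/= gt_max lt_min;
  by move=> /andP[/andP[h1 h2] /andP[h3 h4]]; rewrite ?h1 ?h2 ?h3 ?h4.
Qed.

Lemma cube_bound x : exists k, forall i, `|x ord0 i| < k%:R.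
Proof.
exists (Num.bound (\sum_j `|x ord0 j|)) => i.
apply: le_lt_trans (archi_boundP _); last by rewrite sumr_ge0.
by rewrite (bigD1 i)//= lerDl sumr_ge0.
Qed.

Lemma bigcup_cube : \bigcup_k cube k = setT.
Proof.
apply/seteqP; split=> // x _; have [k xk] := cube_bound x.
by exists k => // i; rewrite /= in_itv/= -ltr_norml.
Qed.

Lemma ae_cubes (P : 'rV[R]_N -> Prop) :
  (forall k, {ae lambda, forall x, cube k x -> P x}) -> {ae lambda, forall x, P x}.
Proof.
move=> /ae_foralln; apply: filterS => x h.
by have : (\bigcup_k cube k) x by [rewrite bigcup_cube]; move=> [k _ /h].
Qed.

Lemma measurable_boxes : (@measurable _ 'rV[R]_N) = <<s boxes >>.
Proof.
apply/seteqP; split; last first.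
  apply: smallest_sub; first exact: sigma_algebra_measurable.
  by move=> _ [a [b ->]]; exact: measurable_box.
have mcoord (i : 'I_N) : measurable_fun (setT : set (g_sigma_algebraType boxes))
    (rV_coord i : g_sigma_algebraType boxes -> measurableTypeR R).
  apply: (@measurability _ _ _ (measurableTypeR R) _ _ (@RGenOInfty.G R)).
    exact: RGenOInfty.measurableE.
  move=> _ [_ [a ->] <-]; rewrite setTI.
  rewrite (_ : _ @^-1` _ = \bigcup_k
      box (fun j => if j == i then a else - k%:R) (fun=> k%:R)).
    apply: bigcup_measurable => k _; apply: sub_sigma_algebra.
    by eexists; eexists.
  apply/seteqP; split => x /=.
    rewrite in_itv/= andbT => ax; have [k xk] := cube_bound x.
    exists k => // j; rewrite /= in_itv/=; have := xk j; rewrite ltr_norml.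
    by case: eqVneq => [->|//] /andP[_ ->]; rewrite andbT.
  by move=> [k _ /(_ i)]; rewrite /= eqxx !in_itv/= andbT => /andP[].
apply: smallest_sub; first exact: smallest_sigma_algebra.
apply: (big_ind (fun F => F `<=` <<s boxes>>)) => //.
  by move=> F G FS GS; rewrite subUset.
by move=> i _ A [B mB <-]; exact: mcoord.
Qed.

Lemma measure_rV_unique (m1 m2 : {measure set 'rV[R]_N -> \bar R}) :
  (forall a b, m1 (box a b) = m2 (box a b)) ->
  (forall k, m1 (cube k) < +oo)%E ->
  forall A, measurable A -> m1 A = m2 A.
Proof.
move=> m12 moo; apply: (measure_unique boxes cube).
- exact: measurable_boxes.
- by move=> _ _ [a [b ->]] [a' [b' ->]]; rewrite box_setI; do 2 eexists.
- by move=> k; do 2 eexists.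
- exact: bigcup_cube.
- by move=> _ [a [b ->]].
- exact: moo.
Qed.

End Boxes.

(** * Lebesgue measure under dilations *)

Section MeasurableMaps.
Context {R : realType} {N : nat}.
Implicit Types (x : 'rV[R]_N).

Lemma measurable_coord (i : 'I_N) :
  measurable_fun [set: 'rV[R]_N] (fun x => x ord0 i : R).
Proof. exact: (measurable_rV_coord i). Qed.

Lemma measurable_dilation (c : R) :
  measurable_fun [set: 'rV[R]_N] (fun x : 'rV[R]_N => c *: x).
Proof.
apply/measurable_fun_rVP => i.
rewrite (_ : _ \o _ = fun x : 'rV[R]_N => c * x ord0 i).
  by apply: measurable_funM => //; exact: measurable_coord.
by apply/funext => x /=; rewrite /rV_coord mxE.
Qed.

Lemma measurable_scaling d (T : measurableType d) (c : T -> R) (f : T -> 'rV[R]_N) :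
  measurable_fun setT c -> measurable_fun setT f ->
  measurable_fun setT (fun t => c t *: f t).
Proof.
move=> mc mf; apply/measurable_fun_rVP => i.
rewrite (_ : _ \o _ = fun t => c t * f t ord0 i).
  apply: measurable_funM => //.
  exact: (measurableT_comp (measurable_coord i) mf).
by apply/funext => x /=; rewrite /rV_coord mxE.
Qed.

Lemma measurable_dotv (f g : 'rV[R]_N -> 'rV[R]_N) :
  (forall i, measurable_fun setT (fun x => f x ord0 i)) ->
  (forall i, measurable_fun setT (fun x => g x ord0 i)) ->
  measurable_fun setT (fun x => dotv (f x) (g x)).
Proof.
move=> mf mg; rewrite /dotv; apply: measurable_sum => i.
exact: measurable_funM.
Qed.

Lemma measurable_enorm (f : 'rV[R]_N -> 'rV[R]_N) :
  (forall i, measurable_fun setT (fun x => f x ord0 i)) ->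
  measurable_fun setT (fun x => enorm (f x)).
Proof.
move=> mf; rewrite /enorm.
apply: (@measurableT_comp _ _ _ _ _ _ (@Num.sqrt R)).
  by apply: continuous_measurable_fun; exact: sqrt_continuous.
exact: measurable_dotv.
Qed.

Lemma measurable_tensor (th : 'I_N -> R -> R) :
  (forall j, measurable_fun setT (th j)) -> measurable_fun setT (tensor th).
Proof.
move=> mth; rewrite /tensor; apply: measurable_prod => i _.
exact: (measurableT_comp (mth i) (measurable_coord i)).
Qed.

End MeasurableMaps.

Section Dilation.
Context {R : realType} {N : nat}.
Local Notation lambda := (@lebesgue_rV R N).

Lemma preimage_dilation_box (c : R) (a b : 'I_N -> R) : 0 < c ->
  (fun x : 'rV[R]_N => c *: x) @^-1` box a b =
  box (fun i => c^-1 * a i) (fun i => c^-1 * b i).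
Proof.
move=> c0; apply/seteqP; split => x /= h i; have := h i;
  by rewrite /= !in_itv/= mxE (mulrC c^-1) (mulrC c^-1) ltr_pdivrMr// ltr_pdivlMr// (mulrC c).
Qed.

Lemma box_empty (a b : 'I_N -> R) i : b i <= a i -> box a b = set0.
Proof.
move=> ba; apply/seteqP; split => x //= /(_ i); rewrite /= in_itv/= => /andP[ax xb].
by have := lt_le_trans (lt_trans ax xb) ba; rewrite ltxx.
Qed.

(** Both sides are measures in [A] that agree on boxes. *)
Lemma lebesgue_dilation (c : R) (A : set 'rV[R]_N) : 0 < c -> measurable A ->
  lambda ((fun x => c *: x) @^-1` A) = ((c ^- N)%:E * lambda A)%E.
Proof.
move=> c0 mA.
have cN0 : 0 <= c ^- N by rewrite invr_ge0 exprn_ge0// ltW.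
pose m1' : {measure set _ -> \bar R} := pushforward lambda (fun x : 'rV[R]_N => c *: x).
pose m1 := m1' (@measurable_dilation R N c).
pose m2 : {measure set _ -> \bar R} := mscale (NngNum cN0) lambda.
have m1box a b : m1 (box a b) = ((c ^- N)%:E * lambda (box a b))%E.
  rewrite /m1/= /pushforward preimage_dilation_box//.
  have [ab|] := pselect (forall i, a i <= b i).
    rewrite !lebesgue_box// -?EFinM => [|i]; last by rewrite ler_pM2l ?invr_gt0.
    congr (_ %:E); under eq_bigr do rewrite -mulrBr.
    by rewrite big_split/= prodr_const card_ord exprVn.
  move=> /existsNP[i /negP]; rewrite -ltNge => ba.
  rewrite (@box_empty a b i) ?(@box_empty _ _ i) ?ler_pM2l ?invr_gt0// ?ltW//.
  by rewrite measure0 mule0.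
rewrite (_ : lambda _ = m1 A)// (_ : (_ * _)%E = m2 A)//.
apply: measure_rV_unique => // k; rewrite m1box lebesgue_box -?EFinM ?ltry//.
by move=> i; rewrite ge0_cp.
Qed.

Lemma ge0_integral_dilation (c : R) (f : 'rV[R]_N -> \bar R) : 0 < c ->
  measurable_fun setT f -> (forall x, 0 <= f x)%E ->
  (\int[lambda]_x f (c *: x) = (c ^- N)%:E * \int[lambda]_x f x)%E.
Proof.
move=> c0 mf f0.
have cN0 : 0 <= c ^- N by rewrite invr_ge0 exprn_ge0// ltW.
rewrite -(@ge0_integral_mscale _ _ _ lambda setT measurableT (NngNum cN0) f mf (fun x _ => f0 x)).
have := @ge0_integral_pushforward _ _ _ _ R _ (@measurable_dilation R N c)
  lambda setT f measurableT mf (fun x _ => f0 x).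
rewrite preimage_setT => <-.
apply: eq_measure_integral; first exact: measurable_dilation.
move=> ? A mA _.
exact: lebesgue_dilation.
Qed.

Lemma integrable_dilation (c : R) (f : 'rV[R]_N -> \bar R) : 0 < c ->
  lambda.-integrable setT f -> lambda.-integrable setT (fun x => f (c *: x)).
Proof.
move=> c0 /integrableP[mf foo]; apply/integrableP; split.
  exact: (measurableT_comp mf (@measurable_dilation R N c)).
rewrite (@ge0_integral_dilation c (fun x => `|f x|)%E)//; last first.
  exact: measurableT_comp.
by rewrite lte_mul_pinfty// ?lee_fin ?invr_ge0 ?exprn_ge0// ltW.
Qed.

Lemma integral_dilation (c : R) (f : 'rV[R]_N -> \bar R) : 0 < c ->
  lambda.-integrable setT f ->
  (\int[lambda]_x f (c *: x) = (c ^- N)%:E * \int[lambda]_x f x)%E.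
Proof.
move=> c0 fi; have mf := measurable_int _ fi.
rewrite integralE [in RHS]integralE.
rewrite muleBr//; last exact: integrable_add_def.
rewrite -!ge0_integral_dilation//; [|exact: measurable_funeneg|exact: measurable_funepos].
by rewrite (funepos_comp f) (funeneg_comp f).
Qed.

End Dilation.

(** * The fundamental lemma of the calculus of variations *)

Section DuBoisReymond.
Context {R : realType} {N : nat}.
Local Notation lambda := (@lebesgue_rV R N).
Implicit Types f : 'rV[R]_N -> R.

Definition tensor_test (M : R) (th : 'I_N -> R -> R) :=
  forall j, smooth1 (th j) /\ forall t, M < `|t| -> th j t = 0.

Definition cube_integrable f := measurable_fun setT f /\
  forall k, lambda.-integrable (cube k) (EFin \o f).

Lemma box_subset_cube (a b : 'I_N -> R) : exists k, box a b `<=` cube k.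
Proof.
have [k kP] := cube_bound (\row_j (`|a j| + `|b j|)).
exists k => x abx i; have := abx i; rewrite /= !in_itv/= => /andP[ax xb].
have := kP i; rewrite mxE ger0_norm ?addr_ge0// => h.
have := ler_norm (b i); have := ler_norm (- a i); rewrite normrN => h1 h2.
have := normr_ge0 (a i); have := normr_ge0 (b i) => h3 h4.
by apply/andP; split; lra.
Qed.

Lemma tensor_bump_cvg (a b : 'I_N -> R) x :
  tensor (fun j => bump (a j) (b j) n) x @[n --> \oo] --> (\1_(box a b) x : R).
Proof.
have -> : \1_(box a b) x = \prod_(j < N) (\1_`]a j, b j[ (x ord0 j) : R).
  rewrite indicE; have [xin|xnin] := boolP (x \in box a b).
    rewrite big1// => j _; rewrite indicE mem_set//.
    by move/set_mem : xin; exact.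
  move: xnin; rewrite notin_setE => /existsNP[j xj].
  by rewrite (bigD1 j)//= indicE memNset// mul0r.
apply: cvg_big => [|j _]; first exact: mul_continuous.
exact: bump_cvg.
Qed.

Lemma tensor_bump_ge0 (a b : 'I_N -> R) n x :
  0 <= tensor (fun j => bump (a j) (b j) n) x.
Proof. by apply: prodr_ge0 => j _; exact: bump_ge0. Qed.

Lemma tensor_bump_le (a b : 'I_N -> R) n x :
  tensor (fun j => bump (a j) (b j) n) x <= \1_(box a b) x.
Proof.
rewrite indicE; have [xin|xnin] := boolP (x \in box a b).
  by apply: prodr_ile1 => j _; rewrite bump_ge0 bump_le1.
move: xnin; rewrite notin_setE => /existsNP[j xj].
by rewrite /tensor (bigD1 j)//= bump_out ?mul0r//; apply/negP.
Qed.

Lemma tensor_test_bump (a b : 'I_N -> R) : exists M, forall n,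
  tensor_test M (fun j => bump (a j) (b j) n).
Proof.
exists (\sum_j (`|a j| + `|b j|)) => n j; split; first exact: smooth1_bump.
move=> t; rewrite (bigD1 j)//= => Mt.
have {Mt} abt : `|a j| + `|b j| < `|t|.
  by apply: le_lt_trans Mt; rewrite lerDl sumr_ge0// => i _; rewrite addr_ge0.
apply: bump_out; apply/negP => /andP[].
have [ha1 ha2] : `|a j| >= a j /\ `|a j| >= - a j by rewrite ler_norm -normrN ler_norm.
have [hb1 hb2] : `|b j| >= b j /\ `|b j| >= - b j by rewrite ler_norm -normrN ler_norm.
by move: abt; case: (ger0P t) => t0 *; lra.
Qed.

Lemma integral_box_eq0 f (a b : 'I_N -> R) : cube_integrable f ->
  (forall M th, tensor_test M th ->
     (\int[lambda]_x (f x * tensor th x)%:E = 0)%E) ->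
  (\int[lambda]_(x in box a b) (f x)%:E = 0)%E.
Proof.
move=> [mf fi] f0; have [k abk] := box_subset_cube a b.
have [M thM] := tensor_test_bump a b.
pose F n x := (f x * tensor (fun j => bump (a j) (b j) n) x)%:E.
have [|||||_ _] := @dominated_convergence _ _ _ lambda setT measurableT F
  (fun x => (f x * \1_(box a b) x)%:E) (fun x => `|(EFin \o f) \_ (cube k) x|)%E.
- move=> n; apply/measurable_EFinP; apply: measurable_funM => //.
  apply: measurable_tensor => j; apply: continuous_measurable_fun.
  exact/smooth1_continuous/smooth1_bump.
- apply/measurable_EFinP; apply: measurable_funM => //.
  by apply: measurable_indic; exact: measurable_box.
- apply/aeW => x _; apply: cvg_EFin; first exact: nearW.
  by apply: cvgMr; exact: tensor_bump_cvg.
- apply: integrable_abse; apply/integrable_restrict; rewrite ?setTI//.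
  exact: measurable_cube.
- apply/aeW => x n _; rewrite /F abse_EFin/= patchE.
  case: ifPn => xk; last first.
    have xb : \1_(box a b) x = 0 :> R.
      by rewrite indicE memNset// => /abk xk'; move: xk; rewrite mem_set.
    have -> : tensor (fun j => bump (a j) (b j) n) x = 0; last by rewrite mulr0 normr0 abse0.
    by apply/le_anti; rewrite tensor_bump_ge0 -xb tensor_bump_le.
  rewrite lee_fin normrM ler_piMr// ger0_norm ?tensor_bump_ge0//.
  by rewrite (le_trans (tensor_bump_le _ _ _ _))// indicE; case: (_ \in _).
rewrite (_ : (fun n => _) = cst 0%E); last first.
  by apply/funext => n; exact: f0 (thM n).
move=> h; rewrite (cvg_unique _ (cvg_cst (0 : \bar R)%E) h)//.
rewrite [LHS]integral_mkcond; apply: eq_integral => x _.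
by rewrite patchE indicE; case: ifP; rewrite ?mulr1 ?mulr0.
Qed.

(** The bumps converge to indicators of boxes, so [f] integrates to zero on every
    box, hence on every measurable subset of a cube, boxes being stable under
    intersection and generating the Borel sets. *)
Lemma ae_eq0_of_tensor_tests f : cube_integrable f ->
  (forall M th, tensor_test M th ->
     (\int[lambda]_x (f x * tensor th x)%:E = 0)%E) ->
  {ae lambda, forall x, f x = 0}.
Proof.
move=> fi f0; have intbox a b := @integral_box_eq0 f a b fi f0.
case: fi => mf fi.
apply: ae_cubes => k.
pose g := (EFin \o f) \_ (cube k).
have gi : lambda.-integrable setT g.
  by apply/integrable_restrict => //; rewrite ?setTI//; exact: measurable_cube.
have g0 : forall S, <<s @boxes R N >> S -> (\int[lambda]_(x in S) g x = 0)%E.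
  have gS S : measurable S -> lambda.-integrable S g.
    by move=> mS; exact: integrableS gi.
  have gT : (\int[lambda]_x g x = 0)%E.
    by rewrite -integral_mkcond; exact: intbox.
  apply: dynkin_induction => //.
  - exact: measurable_boxes.
  - by move=> _ _ [a [b ->]] [a' [b' ->]]; rewrite box_setI; do 2 eexists.
  - by move=> _ [a [b ->]]; rewrite -integral_mkcondr box_setI; exact: intbox.
  - move=> S mS S0.
    have mg : measurable_fun (S `|` ~` S) g by rewrite setUv; exact: measurable_int gi.
    have SC : [disjoint S & ~` S] by exact/disj_setPCl.
    have := integral_setU lambda mS (measurableC mS) mg SC.
    by rewrite setUv gT S0 add0e.
  - move=> F mF tF F0; rewrite integral_bigcup//.
      by apply: eseries0 => n _ _; exact: F0.
    by apply: gS; exact: bigcup_measurable.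
have : ae_eq lambda setT g (cst 0%E).
  apply: integral_ae_eq => // E _ mE; rewrite integral0 g0//.
  by rewrite -measurable_boxes.
apply: filterS => x /(_ I); rewrite /g patchE/= => h xk.
by move: h; rewrite mem_set// => -[].
Qed.

End DuBoisReymond.

(** * The adjoint of the radial derivative *)

Section CompactlySupported.
Context {R : realType}.
Implicit Types f : R -> R.

Lemma smooth1_bounded f M : smooth1 f -> (forall t, M < `|t| -> f t = 0) ->
  exists2 C, 0 <= C & forall t, `|f t| <= C.
Proof.
move=> sf f0; have [M0|M0] := leP 0 M; last first.
  exists 0 => // t; rewrite f0 ?normr0//; exact: lt_le_trans M0 _.
have cf : {within `[- M, M], continuous (fun t => `|f t|)}.
  apply: continuous_subspaceT => t.
  by apply: continuous_comp; [exact: smooth1_continuous|exact: norm_continuous].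
have MM : - M <= M by lra.
have [c _ cP] := EVT_max MM cf.
exists `|f c| => // t; have [tM|tM] := leP `|t| M.
  by apply: cP; rewrite in_itv/= -ler_norml.
by rewrite f0// normr0.
Qed.

Lemma derive1_out f M : (forall t, M < `|t| -> f t = 0) ->
  forall t, M < `|t| -> derive1 f t = 0.
Proof.
move=> f0 t Mt; rewrite derive1E.
rewrite (@near_eq_derive _ _ _ _ (cst 0)); first exact: derive_cst.
near=> s; apply: f0; near: s.
by apply: (@cvgr_gt _ _ _ _ (fun s => `|s|) `|t|) => //; apply: norm_continuous.
Unshelve. all: by end_near. Qed.

Lemma smooth1_scale f c : smooth1 f -> smooth1 (fun t => f (c * t)).
Proof.
move=> sf; rewrite (_ : (fun t => _) = fun t => f (c * t + 0)).
  exact: smooth1_affine.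
by apply/funext => t; rewrite addr0.
Qed.

Lemma smooth1_mul_deriv (g : R -> R) (s : R) : smooth1 g ->
  derive1 (fun t => t * g t) s = g s + s * derive1 g s.
Proof.
move=> sg; have dM := is_deriveM (is_derive_id s (1 : R)) (smooth1_is_derive s sg).
have d : is_derive s (1 : R) (fun t => t * g t) (g s + s * derive1 g s).
  by apply: (is_derive1_eq dM) => //; rewrite /GRing.scale/= mulr1 addrC.
by rewrite derive1E (@derive_val _ _ _ _ _ _ _ d).
Qed.

Lemma derive1_mul_scale f (c t : R) : smooth1 f ->
  derive1 (fun t => t * f (c * t)) t = derive1 (fun z => z * f z) (c * t).
Proof.
move=> sf; rewrite !smooth1_mul_deriv//; last exact: smooth1_scale.
have dl : is_derive t (1 : R) (fun t => c * t) c.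
  by apply: is_derive_eq; rewrite /GRing.scale/=; ring.
have dc := @is_derive1_comp _ f (fun t => c * t) t _ _ (smooth1_is_derive (c * t) sf) dl.
rewrite [X in _ + _ * X]derive1E (@derive_val _ _ _ _ _ _ _ dc).
ring.
Qed.

End CompactlySupported.

Section TensorTests.
Context {R : realType} {N : nat}.
Implicit Types (th : 'I_N -> R -> R) (x : 'rV[R]_N).

Definition mul_at (i : 'I_N) th (j : 'I_N) : R -> R :=
  if j == i then (fun t => t * th j t) else th j.

Lemma tensor_test_mul_at M i th : tensor_test M th -> tensor_test M (mul_at i th).
Proof.
move=> tth j; rewrite /mul_at; case: ifP => _; last exact: tth.
split; first by apply: smooth1M; [exact: smooth1_id|exact: (tth j).1].
by move=> t Mt; rewrite (tth j).2// mulr0.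
Qed.

Lemma tensor_test_deriv_at M i th : tensor_test M th -> tensor_test M (deriv_at i th).
Proof.
move=> tth j; split; first by apply: smooth1_deriv_at => l; exact: (tth l).1.
rewrite /deriv_at; case: ifP => _; last exact: (tth j).2.
exact: derive1_out (tth j).2.
Qed.

Lemma tensor_bounded M th : tensor_test M th ->
  exists2 C, 0 <= C & forall x, `|tensor th x| <= C.
Proof.
move=> tth.
have /choice[C CP] : forall j, exists C, 0 <= C /\ forall t, `|th j t| <= C.
  by move=> j; have [C C0 CP] := smooth1_bounded (tth j).1 (tth j).2; exists C.
exists (\prod_j C j); first by apply: prodr_ge0 => j _; exact: (CP j).1.
move=> x; rewrite /tensor normr_prod; apply: ler_prod => j _.
by rewrite normr_ge0/=; exact: (CP j).2.
Qed.

Lemma tensor_out M th x : tensor_test M th -> (exists j, M < `|x ord0 j|) ->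
  tensor th x = 0.
Proof.
by move=> tth [j Mj]; rewrite /tensor (bigD1 j)//= (tth j).2// mul0r.
Qed.

Lemma continuous_tensor_test M th : tensor_test M th -> continuous (tensor th).
Proof.
by move=> tth; apply: continuous_tensor => j; exact/smooth1_continuous/(tth j).1.
Qed.

Lemma measurable_tensor_test M th : tensor_test M th ->
  measurable_fun setT (tensor th).
Proof.
move=> tth; apply: measurable_tensor => j; apply: continuous_measurable_fun.
exact/smooth1_continuous/(tth j).1.
Qed.

Lemma test_function_tensor_test M th : tensor_test M th -> test_function (tensor th).
Proof.
move=> tth; apply: (@test_function_tensor _ _ _ M) => j; first exact: (tth j).1.
exact: (tth j).2.
Qed.

Definition scale_test (c : R) th (j : 'I_N) : R -> R := fun t => th j (c * t).

Lemma tensor_scale_test c th x : tensor (scale_test c th) x = tensor th (c *: x).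
Proof. by apply: eq_bigr => j _; rewrite mxE. Qed.

Lemma tensor_test_scale_test M c th : 0 < c -> tensor_test M th ->
  tensor_test (c^-1 * M) (scale_test c th).
Proof.
move=> c0 tth j; split; first by apply: smooth1_scale; exact: (tth j).1.
move=> t Mt; apply: (tth j).2; rewrite normrM gtr0_norm//.
by rewrite -ltr_pdivrMl.
Qed.

Lemma partial_mul_scale_test i c th x : (forall j, smooth1 (th j)) ->
  partial i (tensor (mul_at i (scale_test c th))) x =
  tensor (deriv_at i (mul_at i th)) (c *: x).
Proof.
move=> sth; rewrite partial_tensor; last first.
  rewrite /mul_at eqxx; apply: smooth1M; first exact: smooth1_id.
  exact: smooth1_scale.
apply: eq_bigr => j _; rewrite /deriv_at/= /mul_at mxE; case: eqVneq => [->|//].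
exact: derive1_mul_scale.
Qed.

(** [k T + div (z T)] for [T = tensor th]: the [i]-th summand is the partial
    derivative of [z_i T] along the [i]-th coordinate. *)
Definition radial_adjoint (k : R) th x : R :=
  k * tensor th x + \sum_(i < N) tensor (deriv_at i (mul_at i th)) x.

End TensorTests.

Section DerivativeOfDilation.
Context {R : realType}.

Lemma is_derive_prod n (f f' : 'I_n -> R -> R) (s : R) :
  (forall j, is_derive s (1 : R) (f j) (f' j s)) ->
  is_derive s (1 : R) (fun s => \prod_(j < n) f j s)
    (\sum_(i < n) \prod_(j < n) (if j == i then f' j s else f j s)).
Proof.
elim: n f f' => [|n ih] f f' df.
  apply: (is_derive1_eq (is_derive_cst (1 : R) s (1 : R))) => [t|].
    by rewrite big_ord0.
  by rewrite big_ord0.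
have dS := ih (fun j => f (lift ord0 j)) (fun j => f' (lift ord0 j)) (fun j => df _).
have dM := is_deriveM (df ord0) dS.
apply: (is_derive1_eq dM) => [t|].
  by rewrite big_ord_recl.
rewrite /GRing.scale/= big_ord_recl addrC; congr (_ + _).
  by rewrite big_ord_recl/= mulrC.
rewrite mulr_sumr; apply: eq_bigr => i _.
by rewrite big_ord_recl/=; congr (_ * _).
Qed.

Context {N : nat}.
Implicit Types (th : 'I_N -> R -> R) (y : 'rV[R]_N).

(** Each factor [th j (exp (- s) y_j)] has [s]-derivative [- z th'(z)] at
    [z = exp (- s) y_j], and [z th'(z) = (z th)'(z) - th z]: the [N] products
    [tensor th] thus produced, one for each factor, cancel the derivative of
    [exp (- N s)]. *)
Lemma is_derive_dilated_tensor k th y (s : R) : (forall j, smooth1 (th j)) ->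
  is_derive s (1 : R)
    (fun s => expR (- (k + N%:R) * s) * tensor th (expR (- s) *: y))
    (- (expR (- (k + N%:R) * s) * radial_adjoint k th (expR (- s) *: y))).
Proof.
move=> sth; set z := expR (- s) *: y.
pose f' (j : 'I_N) (s : R) := - ((expR (- s) * y ord0 j) *
  derive1 (th j) (expR (- s) * y ord0 j)).
have dN : is_derive s (1 : R) (fun s : R => - s) (- 1).
  exact: is_deriveNid.
have dE := @is_derive1_comp _ expR (fun s => - s) s _ _ (is_derive_expR _) dN.
have df j : is_derive s (1 : R) (fun s => th j (expR (- s) * y ord0 j)) (f' j s).
  have dz : is_derive s (1 : R) (fun s => expR (- s) * y ord0 j)
      (- (expR (- s) * y ord0 j)).
    apply: (is_derive1_eq (is_deriveM dE (is_derive_cst (y ord0 j) s (1 : R)))) => //.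
    by rewrite /GRing.scale/=; ring.
  have dc := @is_derive1_comp _ (th j) _ s _ _ (smooth1_is_derive _ (sth j)) dz.
  by apply: (is_derive1_eq dc) => //; rewrite /f'; ring.
have dT := is_derive_prod df.
have dl : is_derive s (1 : R) (fun s : R => - (k + N%:R) * s) (- (k + N%:R)).
  by apply: is_derive_eq; rewrite /GRing.scale/=; ring.
have dX := @is_derive1_comp _ expR (fun s => - (k + N%:R) * s) s _ _ (is_derive_expR _) dl.
apply: (is_derive1_eq (is_deriveM dX dT)) => [t|].
  congr (_ * _); rewrite /tensor; apply: eq_bigr => j _.
  by rewrite mxE.
rewrite /GRing.scale/= /radial_adjoint.
have TE : \prod_(j < N) th j (expR (- s) * y ord0 j) = tensor th z.
  by apply: eq_bigr => j _; rewrite mxE.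
have -> : \sum_(i < N) tensor (deriv_at i (mul_at i th)) z = N%:R * tensor th z -
    \sum_(i < N) \prod_(j < N) (if j == i then f' j s else th j (expR (- s) * y ord0 j)).
  rewrite -sumrN -[X in X%:R * _]card_ord mulr_natl -sumr_const -big_split/=.
  apply: eq_bigr => i _.
  rewrite -[in RHS]TE {1}/tensor (bigD1 i)//= [in RHS](bigD1 i)//=.
  rewrite [X in _ - X](bigD1 i)//= eqxx.
  rewrite (eq_bigr (fun j => th j (expR (- s) * y ord0 j))); last first.
    by move=> j /negPf ji; rewrite /deriv_at /mul_at ji mxE.
  rewrite [in RHS](eq_bigr (fun j => th j (expR (- s) * y ord0 j)) (F1 := fun j => if j == i then _ else _)); last first.
    by move=> j /negPf ->.
  rewrite /deriv_at /mul_at eqxx mxE smooth1_mul_deriv// /f'.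
  ring.
rewrite TE.
ring.
Qed.

Lemma continuous_radial_adjoint k M th : tensor_test M th ->
  continuous (radial_adjoint k th).
Proof.
move=> tth x.
apply: (@continuousD _ _ _ (fun x => k * tensor th x)
  (fun x => \sum_(i < N) tensor (deriv_at i (mul_at i th)) x)).
  apply: (@continuousM _ _ (fun=> k) (tensor th)); first exact: cst_continuous.
  exact: (continuous_tensor_test tth).
apply: continuous_big => [|i _]; first exact: add_continuous.
exact: (continuous_tensor_test (tensor_test_deriv_at i (tensor_test_mul_at i tth))).
Qed.

Lemma continuous_dilated_adjoint k M th y : tensor_test M th ->
  continuous (fun s : R => expR (- (k + N%:R) * s) *
    radial_adjoint k th (expR (- s) *: y)).
Proof.
move=> tth s.
apply: (@continuousM _ _ (fun s => expR (- (k + N%:R) * s))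
  (fun s => radial_adjoint k th (expR (- s) *: y))).
  apply: continuous_comp; last exact: continuous_expR.
  exact: mulrl_continuous.
apply: (@continuous_comp _ _ _ (fun s => expR (- s) *: y) (radial_adjoint k th)).
  apply: cvgZr_tmp; apply: continuous_comp; [exact: opp_continuous|exact: continuous_expR].
exact: continuous_radial_adjoint tth _.
Qed.

Lemma FTC_dilated_tensor k M th y (S : R) : tensor_test M th -> 0 < S ->
  (\int[lebesgue_measure]_(s in `[0%R, S])
     (expR (- (k + N%:R) * s) * radial_adjoint k th (expR (- s) *: y))%:E =
   (tensor th y - expR (- (k + N%:R) * S) * tensor th (expR (- S) *: y))%:E)%E.
Proof.
move=> tth S0.
pose F s := - (expR (- (k + N%:R) * s) * tensor th (expR (- s) *: y)).
pose f s := expR (- (k + N%:R) * s) * radial_adjoint k th (expR (- s) *: y).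
have dF s : is_derive s (1 : R) F (f s).
  rewrite -[f s]opprK; have dG := is_derive_dilated_tensor k y s (fun j => (tth j).1).
  by have := is_deriveN dG; exact.
have cF : continuous F.
  move=> s; apply: differentiable_continuous; apply/derivable1_diffP.
  by have [] := dF s.
rewrite (@continuous_FTC2 _ f F)//; first last.
- by move=> s _; rewrite derive1E; have /@derive_val := dF s.
- split; first by move=> s _; have [] := dF s.
  + by apply: cvg_at_right_filter; exact: cF.
  + by apply: cvg_at_left_filter; exact: cF.
- by apply: continuous_subspaceT; exact: continuous_dilated_adjoint tth.
- by rewrite -EFinB /F mulr0 oppr0 expR0 mul1r scale1r opprK addrC.
Qed.

End DerivativeOfDilation.

(** * Integrability along rays *)

Section CubeIntegrable.
Context {R : realType} {N : nat}.
Local Notation lambda := (@lebesgue_rV R N).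
Implicit Types (f z : 'rV[R]_N -> R).

Lemma L1loc_cube (f : 'rV[R]_N -> \bar R) k : L1loc f -> lambda.-integrable (cube k) f.
Proof.
move=> [mf fi]; pose K := [set x : 'rV[R]_N | forall i, `[- k%:R, k%:R]%classic (x ord0 i)].
have cK : compact K.
  by apply: (@rV_compact R N (fun=> `[- k%:R, k%:R]%classic)) => i; exact: segment_compact.
apply: (@integrableS _ _ _ lambda K); last exact: fi.
- rewrite (_ : K = \bigcap_(i in [set: 'I_N]) rV_coord i @^-1` `[- k%:R, k%:R]%classic); last first.
    by apply/seteqP; split => x /= h i; [move=> _|]; exact: h.
  apply: fin_bigcap_measurable => // i _.
  by rewrite -[X in measurable X]setTI; exact: measurable_rV_coord.
- exact: measurable_cube.
- by move=> x xk i; apply: subset_itv_oo_cc; exact: xk.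
Qed.

Lemma L1loc_cube_integrable f : L1loc (fun x => (f x)%:E) -> cube_integrable f.
Proof.
move=> fL; split=> [|k]; last exact: L1loc_cube fL.
by apply/measurable_EFinP; exact: fL.1.
Qed.

Definition bounded_on_cube (C : R) (m : nat) z :=
  [/\ measurable_fun setT z, forall x, `|z x| <= C & forall x, ~ cube m x -> z x = 0].

Lemma tensor_bounded_on_cube M (th : 'I_N -> R -> R) : tensor_test M th ->
  exists C m, bounded_on_cube C m (tensor th).
Proof.
move=> tth; have [C C0 CP] := tensor_bounded tth.
exists C, (Num.bound `|M|); split => //; first exact: measurable_tensor_test tth.
move=> x /existsNP[j]; rewrite /= in_itv/= -ltr_norml => /negP; rewrite -leNgt => h.
apply: (tensor_out tth); exists j; apply: lt_le_trans h.
exact: le_lt_trans (ler_norm M) (archi_boundP (normr_ge0 M)).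
Qed.

Lemma integrableM_bounded f z C m : cube_integrable f -> bounded_on_cube C m z ->
  lambda.-integrable setT (fun x => (f x * z x)%:E).
Proof.
move=> [mf fi] [mz zC z0].
apply: (@le_integrable _ _ _ lambda setT measurableT _
  (fun x => C%:E * ((EFin \o f) \_ (cube m)) x)%E).
- by apply/measurable_EFinP; exact: measurable_funM.
- move=> x _; rewrite patchE; case: ifPn => [|/negP xm].
    move=> _; rewrite /= lee_fin !normrM mulrC ler_wpM2r//.
    by rewrite (le_trans (zC x))// ler_norm.
  by rewrite z0 ?mulr0 ?mule0// => ?; apply: xm; rewrite in_setE.
- apply: integrableZl => //; apply/integrable_restrict => //; rewrite ?setTI//.
  exact: measurable_cube.
Qed.

End CubeIntegrable.

Section Slab.
Context {R : realType} {N : nat}.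
Local Notation lambda := (@lebesgue_rV R N).
Local Notation leb := (@lebesgue_measure R).

(** For a function supported in [0 <= s <= S], a bound on the integrals in [x]
    that is uniform in [s] suffices to apply Fubini's theorem. *)
Lemma slab_integrable (F : 'rV[R]_N * measurableTypeR R -> R) (S A : R) :
  measurable_fun setT F ->
  (forall x s, ~ (0 <= s <= S) -> F (x, s) = 0) ->
  (forall s : R, 0 <= s <= S -> (\int[lambda]_x `|F (x, s)|%:E <= A%:E)%E) ->
  (lambda \x leb)%E.-integrable setT (EFin \o F).
Proof.
move=> mF F0 FA; apply/integrable21ltyP; first exact/measurable_EFinP.
apply: (@le_lt_trans _ _ (\int[leb]_(s in `[0%R, S]) A%:E)%E).
  rewrite [leRHS]integral_mkcond; apply: ge0_le_integral => //.
  - by move=> s _; apply: integral_ge0.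
  - apply: (measurable_fun_fubini_tonelli_G (fun p => `|F p|%:E)) => //.
    by apply/measurable_EFinP; exact: measurableT_comp.
  - by apply/(measurable_restrictT _ _).1 => //; exact: measurable_cst.
  - move=> s _; rewrite patchE mem_setE in_itv/=; case: ifPn => [sS|nsS].
      exact: FA.
    by rewrite integral0_eq// => x _; rewrite /= F0 ?normr0//; exact/negP.
rewrite integral_cst//= lebesgue_measure_itv/=; case: ifP => _.
  by rewrite -EFinD -EFinM ltry.
by rewrite mule0.
Qed.

Lemma cube_dilation (S : R) m : exists K, forall s x, s <= S ->
  cube m x -> @cube R N K (expR s *: x).
Proof.
exists (Num.bound (expR S * m%:R)) => s x sS xm i.
have := xm i; rewrite /= !in_itv/= -!ltr_norml mxE normrM ger0_norm ?expR_ge0// => xim.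
apply: le_lt_trans (archi_boundP _); last by rewrite mulr_ge0 ?expR_ge0.
by rewrite ler_pM ?expR_ge0 ?ler_expR// ltW.
Qed.

Lemma cube_integrable_abs (f : 'rV[R]_N -> R) K (B : R) : cube_integrable f -> 0 <= B ->
  exists A : R, (\int[lambda]_y (B * (`|f y| * \1_(cube K) y))%:E = A%:E)%E.
Proof.
move=> [mf fi] B0.
have gi : lambda.-integrable setT (fun y => (B * (`|f y| * \1_(cube K) y))%:E).
  rewrite (_ : (fun y => _) = fun y => (B%:E * `|((EFin \o f) \_ (cube K)) y|)%E).
    apply: integrableZl => //; apply: integrable_abse; apply/integrable_restrict => //.
      exact: measurable_cube.
    by rewrite setTI.
  apply/funext => y; rewrite patchE indicE; case: ifP => _.
    by rewrite abse_EFin -EFinM mulr1.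
  by rewrite abse0 mule0 !mulr0.
by exists (fine (\int[lambda]_y (B * (`|f y| * \1_(cube K) y))%:E)%E); rewrite fineK// integrable_fin_num.
Qed.

(** For [0 <= s <= S] the substitution [y = exp s x] does not increase integrals
    of nonnegative functions, and [exp s] maps the cube that carries [z] into a
    fixed larger cube. *)
Lemma dilation_slab_integrable (w z : 'rV[R]_N -> R) C m (k S : R) :
  cube_integrable w -> bounded_on_cube C m z -> 0 <= S ->
  (lambda \x leb)%E.-integrable setT (fun p : 'rV[R]_N * measurableTypeR R =>
    (\1_`[0, S] p.2 * (expR (- k * p.2) * w (expR p.2 *: p.1) * z p.1))%:E).
Proof.
move=> wi [mz zC z0] S0; have [K KP] := cube_dilation S m.
have C0 : 0 <= C by apply: le_trans (zC 0).
pose B := expR (`|k| * S) * C.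
have B0 : 0 <= B by rewrite mulr_ge0 ?expR_ge0.
have [A AP] := cube_integrable_abs K wi B0.
have mexp : measurable_fun setT (fun p : 'rV[R]_N * measurableTypeR R => expR p.2).
  by apply: (@measurableT_comp _ _ _ _ _ _ expR) => //; exact: measurable_expR.
apply: (@slab_integrable _ S A).
- apply: measurable_funM.
    apply: (@measurableT_comp _ _ _ _ _ _ (\1_`[0, S] : measurableTypeR R -> R) _ snd) => //.
  apply: measurable_funM; last exact: (measurableT_comp mz measurable_fst).
  apply: measurable_funM.
    apply: (measurableT_comp (@measurable_expR R)).
    by apply: measurable_funM.
  apply: (@measurableT_comp _ _ _ _ _ _ w _ (fun p : 'rV[R]_N * measurableTypeR R => expR p.2 *: p.1) wi.1).
  exact: (measurable_scaling mexp measurable_fst).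
- by move=> x s ns /=; rewrite indicE memNset ?mul0r// /= in_itv.
- move=> s /andP[s0 sS].
  pose g y := (B * (`|w y| * \1_(cube K) y))%:E.
  have mg : measurable_fun setT g.
    apply/measurable_EFinP; apply: measurable_funM => //; apply: measurable_funM.
      by apply: measurableT_comp => //; exact: wi.1.
    by apply: measurable_indic; exact: measurable_cube.
  have g0 y : (0 <= g y)%E.
    by rewrite lee_fin mulr_ge0// mulr_ge0// indicE; case: (_ \in _).
  apply: (@le_trans _ _ (\int[lambda]_x g (expR s *: x))%E).
    apply: ge0_le_integral => //.
    - apply/measurable_EFinP; apply: measurableT_comp => //.
      rewrite /=; apply: measurable_funM; first exact: measurable_cst.
      apply: measurable_funM => //; apply: measurable_funM => //.
      by apply: (measurableT_comp wi.1); exact: measurable_dilation.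
    - exact: (measurableT_comp mg (@measurable_dilation R N _)).
    - move=> x _; rewrite /g lee_fin !normrM /=.
      have [xm|xm] := pselect (cube m x); last first.
        by rewrite (z0 x xm) normr0 !mulr0 -lee_fin; exact: g0.
      have -> : \1_(cube K) (expR s *: x) = 1 :> R by rewrite indicE mem_set//; exact: KP.
      rewrite mulr1 (ger0_norm (expR_ge0 _)).
      have i1 : `|\1_`[0, S] s : R| <= 1 by rewrite indicE; case: (_ \in _); rewrite ?normr1 ?normr0.
      apply: (@le_trans _ _ (1 * (expR (- k * s) * `|w (expR s *: x)| * `|z x|))).
        by rewrite ler_wpM2r// mulr_ge0// mulr_ge0// expR_ge0.
      rewrite mul1r /B mulrAC ler_wpM2r// ler_pM ?expR_ge0//.
      rewrite ler_expR (le_trans (ler_norm _))// normrM normrN ler_wpM2l//.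
      by rewrite ger0_norm.
  rewrite ge0_integral_dilation ?expR_gt0// -AP.
  rewrite -[leRHS]mul1e lee_wpmul2r ?integral_ge0// lee_fin.
  by rewrite invf_le1 ?exprn_gt0 ?expR_gt0// exprn_ege1// -expR0 ler_expR.
Qed.

End Slab.

(** * Weak gradients tested against dilated products *)

Section WeakGradientTests.
Context {R : realType} {N : nat}.
Local Notation lambda := (@lebesgue_rV R N).
Implicit Types (u w : 'rV[R]_N -> R) (Du : 'rV[R]_N -> 'rV[R]_N) (th : 'I_N -> R -> R).

Lemma tensor_mul_at i th (x : 'rV[R]_N) :
  tensor (mul_at i th) x = x ord0 i * tensor th x.
Proof.
rewrite /tensor (bigD1 i)//= [in RHS](bigD1 i)//= /mul_at eqxx mulrA; congr (_ * _).
by apply: eq_bigr => j /negPf ->.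
Qed.

Lemma weak_gradient_test u Du i M th : weak_gradient u Du -> tensor_test M th ->
  (\int[lambda]_x (u x * partial i (tensor th) x)%:E =
   - \int[lambda]_x (Du x ord0 i * tensor th x)%:E)%E.
Proof.
move=> [ui Dui ibp] tth.
have dth := tensor_test_deriv_at i tth.
have [C [m Cm]] := tensor_bounded_on_cube tth.
have [C' [m' Cm']] := tensor_bounded_on_cube dth.
have i1 := integrableM_bounded (L1loc_cube_integrable ui) Cm'.
have i2 := integrableM_bounded (L1loc_cube_integrable (Dui i)) Cm.
have := ibp i _ (test_function_tensor_test tth).
rewrite (partial_tensor (tth i).1) /Rintegral => h.
move: (congr1 (@EFin R) h); rewrite EFinN !fineK//; exact: integrable_fin_num.
Qed.

Lemma radial_adjoint_bounded k M th : tensor_test M th ->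
  exists C m, bounded_on_cube C m (@radial_adjoint R N k th).
Proof.
move=> tth; pose tT i := tensor_test_deriv_at i (tensor_test_mul_at i tth).
have [C CP] := choice (fun i => tensor_bounded_on_cube (tT i)).
have [m mP] := choice CP.
have [C0 [m0 [mT TC T0]]] := tensor_bounded_on_cube tth.
exists (`|k| * C0 + \sum_i C i), (m0 + \sum_i m i)%N; split.
- apply: measurable_funD; first exact: measurable_funM.
  by apply: measurable_sum => i; have [] := mP i.
- move=> x; rewrite (le_trans (ler_normD _ _))// lerD//.
    by rewrite normrM ler_wpM2l.
  rewrite (le_trans (ler_norm_sum _ _ _))// ler_sum// => i _.
  by have [] := mP i.
- move=> x xm; have nm m' : (m' <= m0 + \sum_i m i)%N -> ~ cube m' x.
    move=> mm xm'; apply: xm => i; have := xm' i; rewrite /= !in_itv/= -!ltr_norml => h.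
    by apply: lt_le_trans h _; rewrite ler_nat.
  rewrite /radial_adjoint T0 ?mulr0 ?add0r; last exact/nm/leq_addr.
  rewrite big1// => i _; have [_ _ ->//] := mP i.
  by apply: nm; rewrite (bigD1 i)//= addnCA leq_addr.
Qed.

(** The [i]-th coordinate of the weak gradient is tested against
    [x_i T (c x)], whose [i]-th partial derivative is the [i]-th summand of
    [div (z T)] at [z = c x]. *)
Lemma radial_weak_gradient u Du w k c M th : 0 < c -> weak_gradient u Du ->
  cube_integrable w -> {ae lambda, forall x, w x = dotv x (Du x) - k * u x} ->
  tensor_test M th ->
  (\int[lambda]_x (w x * tensor th (c *: x))%:E =
   - \int[lambda]_x (u x * radial_adjoint k th (c *: x))%:E)%E.
Proof.
move=> c0 wg wi wE tth; have [ui Dui _] := wg.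
have sth j := (tth j).1.
have tc := tensor_test_scale_test c0 tth.
have tm i := tensor_test_mul_at i tc.
have td i := tensor_test_deriv_at i (tm i).
have [C [m Cm]] := tensor_bounded_on_cube tc.
have iu := integrableM_bounded (L1loc_cube_integrable ui) Cm.
have iw := integrableM_bounded wi Cm.
have iDu i : lambda.-integrable setT
    (fun x => (Du x ord0 i * tensor (mul_at i (scale_test c th)) x)%:E).
  have [C' [m' Cm']] := tensor_bounded_on_cube (tm i).
  exact: integrableM_bounded (L1loc_cube_integrable (Dui i)) Cm'.
have iud i : lambda.-integrable setT
    (fun x => (u x * partial i (tensor (mul_at i (scale_test c th))) x)%:E).
  have [C' [m' Cm']] := tensor_bounded_on_cube (td i).
  rewrite (partial_tensor (tm i i).1).
  exact: integrableM_bounded (L1loc_cube_integrable ui) Cm'.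
pose a i := fine (\int[lambda]_x (u x * partial i (tensor (mul_at i (scale_test c th))) x)%:E).
pose t := fine (\int[lambda]_x (u x * tensor (scale_test c th) x)%:E).
transitivity (- (\sum_i a i) - k * t)%:E.
  transitivity (\int[lambda]_x
      (\sum_i (Du x ord0 i * tensor (mul_at i (scale_test c th)) x)%:E +
       (- k)%:E * (u x * tensor (scale_test c th) x)%:E))%E.
    apply: ae_eq_integral => //.
    - under eq_fun do rewrite -tensor_scale_test.
      exact: measurable_int iw.
    - apply: emeasurable_funD; last first.
        by apply: emeasurable_funM => //; exact: measurable_int iu.
      by apply: emeasurable_sum => i; exact: measurable_int (iDu i).
    - apply: filterS wE => x wE _; rewrite wE -tensor_scale_test.
      rewrite sumEFin -EFinM -EFinD; congr EFin; rewrite mulrBl /dotv mulr_suml mulNr mulrA.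
      by congr (_ - _); apply: eq_bigr => i _; rewrite tensor_mul_at; ring.
  rewrite integralD//; last 2 first.
  - exact: integrable_sum.
  - exact: integrableZl.
  rewrite integral_sum// integralZl//.
  have -> : (\int[lambda]_x (u x * tensor (scale_test c th) x)%:E = t%:E)%E.
    by rewrite fineK// integrable_fin_num.
  rewrite (eq_bigr (fun i => (- a i)%:E)) => [|i _].
    by rewrite sumEFin -EFinM -EFinD sumrN mulNr.
  rewrite EFinN /a fineK ?integrable_fin_num//.
  by rewrite (weak_gradient_test i wg (tm i)) oppeK.
transitivity (- (\int[lambda]_x
      (\sum_i (u x * partial i (tensor (mul_at i (scale_test c th))) x)%:E +
       k%:E * (u x * tensor (scale_test c th) x)%:E)))%E.
  rewrite integralD//; last 2 first.
  - exact: integrable_sum.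
  - exact: integrableZl.
  rewrite integral_sum// integralZl//.
  have -> : (\int[lambda]_x (u x * tensor (scale_test c th) x)%:E = t%:E)%E.
    by rewrite fineK// integrable_fin_num.
  rewrite (eq_bigr (fun i => (a i)%:E)) => [|i _].
    by rewrite sumEFin -EFinM -EFinD -EFinN opprD.
  by rewrite /a fineK ?integrable_fin_num.
congr (- _)%E; apply: eq_integral => x _.
rewrite sumEFin -EFinM -EFinD; congr EFin.
rewrite /radial_adjoint mulrDr addrC tensor_scale_test mulr_sumr; congr (_ + _); first by ring.
by apply: eq_bigr => i _; rewrite partial_mul_scale_test.
Qed.

End WeakGradientTests.

(** * The fundamental theorem of calculus along rays *)

Section RayIntegral.
Context {R : realType} {N : nat}.
Local Notation lambda := (@lebesgue_rV R N).
Local Notation leb := (@lebesgue_measure R).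
Implicit Types (u w : 'rV[R]_N -> R) (Du : 'rV[R]_N -> 'rV[R]_N) (th : 'I_N -> R -> R).

(** The indicator of [`[0, S]] turns integrals over the segment into integrals
    over the whole line, the form in which Fubini's theorem applies. *)
Definition ray_integrand (k S : R) w (p : 'rV[R]_N * measurableTypeR R) : R :=
  \1_`[0, S] p.2 * (expR (- k * p.2) * w (expR p.2 *: p.1)).

Lemma cube_integrable_dilation u (c : R) : 0 <= c -> cube_integrable u ->
  cube_integrable (fun x => u (expR c *: x)).
Proof.
move=> c0 [mu ui]; split.
  exact: (measurableT_comp mu (@measurable_dilation R N _)).
move=> m; have [K KP] := @cube_dilation R N c m.
have gi : lambda.-integrable setT ((EFin \o u) \_ (cube K)).
  by apply/integrable_restrict; rewrite ?setTI//; exact: measurable_cube.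
have := integrable_dilation (expR_gt0 c) gi.
move=> /(@integrableS _ _ _ _ setT (cube m)) h.
have {h} h := h measurableT (@measurable_cube R N m) (fun _ _ => I).
apply: eq_integrable h; first exact: measurable_cube.
by move=> x /set_mem xm /=; rewrite patchE mem_set//; exact: KP.
Qed.

Lemma bounded_on_cube_indic (K : nat) : bounded_on_cube 1 K (\1_(@cube R N K) : _ -> R).
Proof.
split; first by apply: measurable_indic; exact: measurable_cube.
  by move=> x; rewrite indicE; case: (_ \in _); rewrite ?normr1 ?normr0.
by move=> x xK; rewrite indicE memNset.
Qed.

Lemma ray_integrable k S w : 0 <= S -> cube_integrable w ->
  {ae lambda, forall x, leb.-integrable setT (fun s => (ray_integrand k S w (x, s))%:E)}.
Proof.
move=> S0 wi.
apply: ae_cubes => m.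
have := ae_integrable1 (dilation_slab_integrable k wi (bounded_on_cube_indic m) S0).
apply: filterS => x + xm; apply: eq_integrable => // s _ /=.
by rewrite [X in _ * (_ * X)]indicE mem_set// mulr1.
Qed.

Lemma measurable_ray_integrand k S w : measurable_fun setT w ->
  measurable_fun setT (ray_integrand k S w).
Proof.
move=> mw; apply: measurable_funM.
  by apply: (@measurableT_comp _ _ _ _ _ _ (\1_`[0, S] : measurableTypeR R -> R) _ snd).
apply: measurable_funM.
  by apply: (measurableT_comp (@measurable_expR R)); exact: measurable_funM.
apply: (@measurableT_comp _ _ _ _ _ _ w _ (fun p : 'rV[R]_N * measurableTypeR R => expR p.2 *: p.1) mw).
apply: measurable_scaling => //.
exact: (measurableT_comp (@measurable_expR R)).
Qed.

(** Positive and negative parts are treated separately, because the integral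
    need not converge at every [x]. *)
Lemma measurable_ray_integral k S w : measurable_fun setT w ->
  measurable_fun setT (fun x => \int[leb]_s (ray_integrand k S w (x, s))%:E)%E.
Proof.
move=> mw; have mh := measurable_ray_integrand k S mw.
pose E p := (ray_integrand k S w p)%:E.
have mE : measurable_fun setT E by exact/measurable_EFinP.
rewrite (_ : (fun x => _) = fun x =>
    (\int[leb]_s (E^\+ (x, s)) - \int[leb]_s (E^\- (x, s)))%E).
  apply: emeasurable_funB.
    by apply: (measurable_fun_fubini_tonelli_F _ (measurable_funepos mE)).
  by apply: (measurable_fun_fubini_tonelli_F _ (measurable_funeneg mE)).
apply/funext => x; rewrite integralE; congr (_ - _)%E; apply: eq_integral => s _.
  exact: (congr1 (@^~ s) (funepos_comp E (fun s => (x, s)))).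
exact: (congr1 (@^~ s) (funeneg_comp E (fun s => (x, s)))).
Qed.

Lemma cube_integrable_ray_integral k S w : 0 <= S -> cube_integrable w ->
  cube_integrable (fun x => fine (\int[leb]_s (ray_integrand k S w (x, s))%:E)%E).
Proof.
move=> S0 wi; have mP := measurable_ray_integral k S wi.1.
split; first exact: (measurableT_comp _ mP).
move=> m.
have := integrable_fubini_F (dilation_slab_integrable k wi (bounded_on_cube_indic m) S0).
move=> /(@integrableS _ _ _ _ setT (cube m)) h.
have {h} h := h measurableT (@measurable_cube R N m) (fun _ _ => I).
apply: le_integrable h; first exact: measurable_cube.
  by apply/measurable_EFinP; apply: (measurableT_comp _ (measurable_funTS mP)).
move=> x xm; rewrite /fubini_F.
have -> : (\int[leb]_y (\1_`[0%R, S] y * (expR (- k * y) * w (expR y *: x) * \1_(cube m) x))%:E =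
    \int[leb]_s (ray_integrand k S w (x, s))%:E)%E.
  by apply: eq_integral => s _; rewrite [X in _ * (_ * X)]indicE mem_set// mulr1.
by rewrite /=; case: (\int[leb]_s _)%E => [r| |]/=; rewrite ?lexx// ?normr0 ?leey.
Qed.

End RayIntegral.

Section RadialFundamentalTheorem.
Context {R : realType} {N : nat}.
Local Notation lambda := (@lebesgue_rV R N).
Local Notation leb := (@lebesgue_measure R).
Implicit Types (u w : 'rV[R]_N -> R) (Du : 'rV[R]_N -> 'rV[R]_N) (th : 'I_N -> R -> R).

Lemma bounded_on_cube_dilation C m (z : 'rV[R]_N -> R) (S : R) :
  bounded_on_cube C m z -> exists K, forall s, s <= S ->
  bounded_on_cube C K (fun x => z (expR (- s) *: x)).
Proof.
move=> [mz zC z0]; have [K KP] := @cube_dilation R N S m.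
exists K => s sS; split => //.
  exact: (measurableT_comp mz (@measurable_dilation R N _)).
move=> x xK; apply: z0 => xm; apply: xK.
by have := KP s _ sS xm; rewrite scalerA -expRD addrN expR0 scale1r.
Qed.

(** Substitute [y = exp s x], then test the weak gradient at the factor [exp (- s)]. *)
Lemma integral_ray_tensor u Du w k S M th (s : R) : weak_gradient u Du ->
  cube_integrable w -> {ae lambda, forall x, w x = dotv x (Du x) - k * u x} ->
  tensor_test M th ->
  (\int[lambda]_x (ray_integrand k S w (x, s) * tensor th x)%:E =
   \int[lambda]_x (\1_`[0%R, S] s * (u x * - (expR (- (k + N%:R) * s) *
        radial_adjoint k th (expR (- s) *: x))))%:E)%E.
Proof.
move=> wg wi wE tth; have [ui _ _] := wg.
have tc := tensor_test_scale_test (expR_gt0 (- s)) tth.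
have [C [m Cm]] := tensor_bounded_on_cube tc.
have iw := integrableM_bounded wi Cm.
have [C' [m' Qm]] := @radial_adjoint_bounded R N k M th tth.
have [K Km] := bounded_on_cube_dilation s Qm.
have iq := integrableM_bounded (L1loc_cube_integrable ui) (Km s (lexx s)).
pose c : R := \1_`[0%R, S] s * expR (- k * s).
transitivity (\int[lambda]_x (c%:E * (w (expR s *: x) * tensor (scale_test (expR (- s)) th) (expR s *: x))%:E))%E.
  apply: eq_integral => x _; rewrite -EFinM; congr EFin.
  rewrite tensor_scale_test scalerA -expRD addNr expR0 scale1r /ray_integrand/= /c; ring.
have iwd := integrable_dilation (expR_gt0 s) iw.
rewrite integralZl//.
rewrite (integral_dilation (expR_gt0 s) iw).
under eq_integral do rewrite tensor_scale_test.
rewrite (radial_weak_gradient (expR_gt0 (- s)) wg wi wE tth).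
transitivity (\int[lambda]_x ((- (c * expR s ^- N))%:E *
    (u x * radial_adjoint k th (expR (- s) *: x))%:E))%E.
  by rewrite integralZl// muleN EFinN mulNe EFinM muleN muleA.
apply: eq_integral => x _; rewrite -EFinM; congr EFin.
have -> : expR s ^- N = expR (- (N%:R * s)) by rewrite expRN expRM_natl.
rewrite (_ : - (k + N%:R) * s = - k * s + - (N%:R * s)); last by ring.
rewrite expRD /c; ring.
Qed.

(** Exchange the integrals; the inner one is then over [s] and the integrand is a
    classical derivative in [s]. *)
Lemma integral_adjoint_slab u k M th (S : R) : cube_integrable u ->
  tensor_test M th -> 0 < S ->
  (\int[leb]_s \int[lambda]_x (\1_`[0%R, S] s * (u x * - (expR (- (k + N%:R) * s) *
        radial_adjoint k th (expR (- s) *: x))))%:E =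
   \int[lambda]_x (u x *
       (expR (- (k + N%:R) * S) * tensor th (expR (- S) *: x) - tensor th x))%:E)%E.
Proof.
move=> ui tth S0; set l := k + N%:R.
have [C [m Qm]] := @radial_adjoint_bounded R N k M th tth.
have [K Km] := bounded_on_cube_dilation S Qm.
have C0 : 0 <= C by have [_ QC _] := Qm; apply: le_trans (QC 0).
pose B := expR (`|l| * S) * C.
have B0 : 0 <= B by rewrite mulr_ge0 ?expR_ge0.
have [A AP] := cube_integrable_abs K ui B0.
pose F (p : 'rV[R]_N * measurableTypeR R) : R := \1_`[0, S] p.2 *
  (u p.1 * - (expR (- l * p.2) * radial_adjoint k th (expR (- p.2) *: p.1))).
have mF : measurable_fun setT F.
  apply: measurable_funM.
    by apply: (@measurableT_comp _ _ _ _ _ _ (\1_`[0, S] : measurableTypeR R -> R) _ snd).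
  apply: measurable_funM; first exact: (measurableT_comp ui.1 measurable_fst).
  apply: measurableT_comp => //; apply: measurable_funM.
    by apply: (measurableT_comp (@measurable_expR R)); exact: measurable_funM.
  have [mQ _ _] := Qm.
  apply: (@measurableT_comp _ _ _ _ _ _ (radial_adjoint k th) _
    (fun p : 'rV[R]_N * measurableTypeR R => expR (- p.2) *: p.1) mQ).
  apply: measurable_scaling => //.
  by apply: (measurableT_comp (@measurable_expR R)); exact: measurableT_comp.
have Fi : (lambda \x leb)%E.-integrable setT (EFin \o F).
  apply: (@slab_integrable _ _ F S A) => //.
  - by move=> x s ns; rewrite /F/= indicE memNset ?mul0r// /= in_itv.
  - move=> s /andP[s0 sS]; rewrite -AP; apply: ge0_le_integral => //.
    + apply/measurable_EFinP; apply: measurableT_comp => //.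
      exact: (measurableT_comp mF (measurable_pair2 s)).
    + apply/measurable_EFinP; apply: measurable_funM => //; apply: measurable_funM.
        by apply: measurableT_comp => //; exact: ui.1.
      by apply: measurable_indic; exact: measurable_cube.
    + move=> x _; rewrite lee_fin /F/= !normrM normrN.
      have [_ QC Q0] := Km s sS.
      have [xK|xK] := pselect (cube K x); last first.
        by rewrite normrM (Q0 x xK) normr0 !mulr0 indicE memNset// !mulr0.
      rewrite (_ : \1_(cube K) x = 1) ?mulr1; last by rewrite indicE mem_set.
      have i1 : `|\1_`[0, S] s : R| <= 1 by rewrite indicE; case: (_ \in _); rewrite ?normr1 ?normr0.
      rewrite -[leRHS]mul1r ler_pM// mulrC ler_wpM2r// normrM /B ler_pM//.
      rewrite ger0_norm ?expR_ge0// ler_expR (le_trans (ler_norm _))// normrM normrN.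
      by rewrite ler_wpM2l// ger0_norm.
rewrite -(Fubini Fi); apply: eq_integral => x _.
transitivity (\int[leb]_(s in `[0%R, S]) ((- u x)%:E *
   (expR (- l * s) * radial_adjoint k th (expR (- s) *: x))%:E))%E.
  rewrite [RHS]integral_mkcond; apply: eq_integral => s _.
  rewrite patchE /F/= indicE; case: (_ \in _); last by rewrite mul0r.
  by rewrite mul1r mulrN -mulNr EFinM.
rewrite integralZl//; last first.
  apply: continuous_compact_integrable; first exact: segment_compact.
  by apply: continuous_subspaceT; exact: continuous_dilated_adjoint tth.
rewrite (FTC_dilated_tensor _ _ tth S0) -EFinM; congr EFin; rewrite /l; ring.
Qed.

(** The function [exp (- k s) u (exp s x)] of [s] has derivative
    [exp (- k s) (y . grad u - k u)] at [y = exp s x].  The weight [k = 0] serves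
    for [phi] and [k > 2 - N] for [mu].  Taking for [w] any representative almost
    everywhere of the radial expression allows a choice of sign where one is
    known (weight_growth). *)
Lemma radial_FTC u Du w k S : weak_gradient u Du ->
  cube_integrable w -> {ae lambda, forall x, w x = dotv x (Du x) - k * u x} ->
  0 < S ->
  {ae lambda, forall x, leb.-integrable `[0, S] (fun s => (expR (- k * s) * w (expR s *: x))%:E) /\
    (\int[leb]_(s in `[0%R, S]) (expR (- k * s) * w (expR s *: x))%:E =
     (expR (- k * S) * u (expR S *: x) - u x)%:E)%E}.
Proof.
move=> wg wi wE S0; have [/L1loc_cube_integrable ui _ _] := wg.
have aeint := ray_integrable k (ltW S0) wi.
pose P x := fine (\int[leb]_s (ray_integrand k S w (x, s))%:E)%E.
have Pi : cube_integrable P := cube_integrable_ray_integral k (ltW S0) wi.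
have udi := cube_integrable_dilation (ltW S0) ui.
pose f x := expR (- k * S) * u (expR S *: x) - u x - P x.
have fi : cube_integrable f.
  split.
    apply: measurable_funB; last exact: Pi.1.
    by apply: measurable_funB; [apply: measurable_funM => //; exact: udi.1|exact: ui.1].
  move=> m; have mc := @measurable_cube R N m.
  apply: (@integrableB _ _ _ lambda _ mc (fun x => (expR (- k * S) * u (expR S *: x) - u x)%:E) (EFin \o P)).
    apply: (@integrableB _ _ _ lambda _ mc (fun x => (expR (- k * S) * u (expR S *: x))%:E) (EFin \o u)).
      exact: (@integrableZl _ _ _ lambda _ mc (expR (- k * S)) _ (udi.2 m)).
    exact: ui.2.
  exact: Pi.2.
have f0 : {ae lambda, forall x, f x = 0}.
  apply: ae_eq0_of_tensor_tests => // M th tth.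
  have [C [m Cm]] := tensor_bounded_on_cube tth.
  have i1 := integrableM_bounded udi Cm.
  have i2 := integrableM_bounded ui Cm.
  have i3 := integrableM_bounded Pi Cm.
  have E3 : (\int[lambda]_x (P x * tensor th x)%:E =
      (expR (- k * S))%:E * \int[lambda]_x (u (expR S *: x) * tensor th x)%:E -
      \int[lambda]_x (u x * tensor th x)%:E)%E.
    have [C' [m' [mT TC T0]]] := tensor_bounded_on_cube tth.
    pose G (p : 'rV[R]_N * measurableTypeR R) := (ray_integrand k S w p * tensor th p.1)%:E.
    have Gi : (lambda \x leb)%E.-integrable setT G.
      apply: eq_integrable (dilation_slab_integrable k wi Cm (ltW S0)) => //.
      by move=> p _; rewrite /G /ray_integrand -!mulrA.
    transitivity (\int[lambda]_x \int[leb]_s G (x, s))%E.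
      apply: ae_eq_integral => //.
      - exact: measurable_int i3.
      - exact: measurable_fubini_F Gi.
      - apply: filterS aeint => x hi _.
        rewrite /G/=; under eq_integral do rewrite EFinM.
        by rewrite integralZr// /P EFinM fineK// integrable_fin_num.
    rewrite (Fubini Gi) /G/=.
    under eq_integral do rewrite (integral_ray_tensor _ _ wg wi wE tth).
    rewrite (integral_adjoint_slab k ui tth S0).
    have tcS := tensor_test_scale_test (expR_gt0 (- S)) tth.
    have [D [d Dd]] := tensor_bounded_on_cube tcS.
    have iS := integrableM_bounded ui Dd.
    have -> : (\int[lambda]_x (u (expR S *: x) * tensor th x)%:E =
        (expR S ^- N)%:E * \int[lambda]_x (u x * tensor th (expR (- S) *: x))%:E)%E.
      under [in RHS]eq_integral do rewrite -tensor_scale_test.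
      rewrite -(integral_dilation (expR_gt0 S) iS); apply: eq_integral => x _.
      by rewrite tensor_scale_test scalerA -expRD addNr expR0 scale1r.
    have iS' : lambda.-integrable setT (fun x => (u x * tensor th (expR (- S) *: x))%:E).
      by under eq_fun do rewrite -tensor_scale_test.
    rewrite muleA -EFinM -integralZl// -integralB//; last exact: integrableZl.
    apply: eq_integral => x _; rewrite -EFinM -EFinB; congr EFin.
    have -> : expR S ^- N = expR (- (N%:R * S)) by rewrite expRN expRM_natl.
    rewrite (_ : - (k + N%:R) * S = - k * S + - (N%:R * S)); last by ring.
    rewrite expRD; ring.
  transitivity (\int[lambda]_x ((expR (- k * S))%:E * (u (expR S *: x) * tensor th x)%:E
      - (u x * tensor th x)%:E - (P x * tensor th x)%:E))%E.
    apply: eq_integral => x _; rewrite -EFinM -!EFinB; congr EFin; rewrite /f; ring.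
  rewrite integralB//; last by apply: integrableB => //; exact: integrableZl.
  rewrite integralB//; last exact: integrableZl.
  rewrite integralZl// E3 subee// fin_numB fin_numM ?integrable_fin_num//.
apply: filterS2 aeint f0 => x hi; rewrite /f /P => fx.
have pE : (fun s => (ray_integrand k S w (x, s))%:E) =
    (fun s => (expR (- k * s) * w (expR s *: x))%:E) \_ `[0, S].
  apply/funext => s; rewrite patchE /ray_integrand/= indicE.
  by case: (_ \in _); rewrite ?mul1r ?mul0r.
have hi2 : leb.-integrable `[0, S] (fun s => (expR (- k * s) * w (expR s *: x))%:E).
  by apply/integrable_mkcond => //; rewrite -pE.
split => //; rewrite integral_mkcond -pE.
by rewrite -[LHS]fineK ?integrable_fin_num//; congr EFin; apply/esym/eqP; rewrite -subr_eq0 fx.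
Qed.

End RadialFundamentalTheorem.

(** * The Euclidean norm and a weighted Cauchy-Schwarz inequality *)

Section EuclideanNorm.
Context {R : realType} {N : nat}.
Implicit Types x y : 'rV[R]_N.

Lemma enorm_ge0 x : 0 <= enorm x.
Proof. exact: sqrtr_ge0. Qed.

Lemma dotvv_ge0 x : 0 <= dotv x x.
Proof. by rewrite -enorm_sqr sqr_ge0. Qed.

Lemma dotvZl c x y : dotv (c *: x) y = c * dotv x y.
Proof. by rewrite /dotv mulr_sumr; apply: eq_bigr => i _; rewrite mxE mulrA. Qed.

Lemma dotvC x y : dotv x y = dotv y x.
Proof. by apply: eq_bigr => i _; rewrite mulrC. Qed.

Lemma enormZ c x : 0 <= c -> enorm (c *: x) = c * enorm x.
Proof.
move=> c0; rewrite /enorm dotvZl dotvC dotvZl mulrA -expr2.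
by rewrite sqrtrM ?sqr_ge0// sqrtr_sqr ger0_norm.
Qed.

(** The quadratic [t |-> |t x - y|^2] is nonnegative. *)
Lemma dotv_sqr_le x y : dotv x y ^+ 2 <= dotv x x * dotv y y.
Proof.
have key t : 0 <= dotv x x * t ^+ 2 - 2 * dotv x y * t + dotv y y.
  have -> : dotv x x * t ^+ 2 - 2 * dotv x y * t + dotv y y =
      \sum_(i < N) (x ord0 i * t - y ord0 i) ^+ 2.
    rewrite /dotv mulr_suml mulr_sumr mulr_suml -sumrB -big_split/=.
    by apply: eq_bigr => i _; ring.
  by apply: sumr_ge0 => i _; rewrite sqr_ge0.
have [x0|x0] := eqVneq (dotv x x) 0.
  have h t := key t; rewrite x0 mul0r.
  have [->|xy0] := eqVneq (dotv x y) 0; first by rewrite expr0n.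
  have := key ((1 + dotv y y) / (2 * dotv x y)); rewrite x0 mul0r.
  rewrite (_ : 0 - _ + _ = -1) ?oppr_ge0 ?ler10//; field; by rewrite xy0.
have xx : 0 < dotv x x by rewrite lt_def x0 dotvv_ge0.
have := key (dotv x y / dotv x x).
rewrite (_ : _ + _ = dotv y y - dotv x y ^+ 2 / dotv x x); last by field.
by rewrite subr_ge0 ler_pdivrMr// mulrC.
Qed.

End EuclideanNorm.

Section CauchySchwarz.
Context {R : realType}.
Local Notation leb := (@lebesgue_measure R).

Lemma integral_expR (b S : R) : b != 0 -> 0 < S ->
  (\int[leb]_(s in `[0%R, S]) (expR (- b * s))%:E = ((1 - expR (- b * S)) / b)%:E)%E.
Proof.
move=> b0 S0; pose F s := - b^-1 * expR (- b * s).
have dF s : is_derive s (1 : R) F (expR (- b * s)).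
  have dl : is_derive s (1 : R) (fun s : R => - b * s) (- b).
    by apply: is_derive_eq; rewrite /GRing.scale/=; ring.
  have dX := @is_derive1_comp _ expR (fun s => - b * s) s _ _ (is_derive_expR _) dl.
  apply: (is_derive1_eq (is_deriveZ (- b^-1) dX)) => //.
  by rewrite /GRing.scale/=; field.
have cF : continuous F.
  move=> s; apply: differentiable_continuous; apply/derivable1_diffP.
  by have [] := dF s.
rewrite (@continuous_FTC2 _ (fun s => expR (- b * s)) F)//; first last.
- by move=> s _; rewrite derive1E; have /@derive_val := dF s.
- split; first by move=> s _; have [] := dF s.
  + by apply: cvg_at_right_filter; exact: cF.
  + by apply: cvg_at_left_filter; exact: cF.
- apply: continuous_subspaceT => s; apply: continuous_comp; last exact: continuous_expR.
  exact: mulrl_continuous.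
- by rewrite -EFinB /F mulr0 expR0; congr EFin; field.
Qed.

(** Integrate [exp (b s) (f - t exp (- b s))^2 >= 0] and choose the best [t],
    the quotient of the integrals of [f] and of [exp (- b s)]. *)
Lemma weighted_cauchy_schwarz (f : R -> R) (b S : R) : 0 < b -> 0 < S ->
  leb.-integrable `[0, S] (fun s => (f s)%:E) ->
  ((\int[leb]_(s in `[0%R, S]) (f s)%:E) ^+ 2 <=
   ((1 - expR (- b * S)) / b)%:E * \int[leb]_(s in `[0%R, S]) (expR (b * s) * f s ^+ 2)%:E)%E.
Proof.
move=> b0 S0 fi; set W := (1 - expR (- b * S)) / b.
have W0 : 0 < W by rewrite divr_gt0// subr_gt0 -expR0 ltr_expR nmulr_rlt0 ?oppr_lt0.
have If : (\int[leb]_(s in `[0%R, S]) (f s)%:E)%E \is a fin_num by exact: integrable_fin_num.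
pose I := fine (\int[leb]_(s in `[0%R, S]) (f s)%:E)%E.
have mf : measurable_fun `[0, S] f by apply/measurable_EFinP; exact: measurable_int fi.
pose h s := expR (b * s) * f s ^+ 2.
have mh : measurable_fun `[0, S] (fun s => (h s)%:E).
  apply/measurable_EFinP; apply: measurable_funM; last exact: measurable_funX.
  apply: measurable_funTS; apply: (measurableT_comp (@measurable_expR R)).
  exact: measurable_funM.
have h0 s : (0 <= (h s)%:E)%E by rewrite lee_fin mulr_ge0 ?expR_ge0 ?sqr_ge0.
have [Q0|] := eqVneq (\int[leb]_(s in `[0%R, S]) (h s)%:E)%E +oo%E.
  by rewrite Q0 gt0_muley ?lte_fin// leey.
rewrite -ltey => Qoo.
have hi : leb.-integrable `[0, S] (fun s => (h s)%:E).
  apply/integrableP; split => //; apply: le_lt_trans Qoo.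
  by under eq_integral do rewrite gee0_abs//.
have ei : leb.-integrable `[0, S] (fun s => (expR (- b * s))%:E).
  apply: continuous_compact_integrable; first exact: segment_compact.
  apply: continuous_subspaceT => s; apply: continuous_comp; last exact: continuous_expR.
  exact: mulrl_continuous.
pose t := I / W.
have le : (\int[leb]_(s in `[0%R, S]) ((2 * t)%:E * (f s)%:E - (t ^+ 2)%:E * (expR (- b * s))%:E)
    <= \int[leb]_(s in `[0%R, S]) (h s)%:E)%E.
  apply: le_integral => //.
    by apply: integrableB => //; exact: integrableZl.
  move=> s _; rewrite -!EFinM -EFinB lee_fin -subr_ge0 /h.
  have -> : expR (b * s) * f s ^+ 2 - (2 * t * f s - t ^+ 2 * expR (- b * s)) =
     expR (b * s) * (f s - t * expR (- b * s)) ^+ 2.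
    rewrite mulNr expRN; field; by rewrite gt_eqF ?expR_gt0.
  by rewrite mulr_ge0 ?expR_ge0 ?sqr_ge0.
move: le; rewrite integralB//; try exact: integrableZl.
rewrite !integralZl// integral_expR ?gt_eqF// -/W -[X in (X ^+ 2)%E]fineK// -/I.
rewrite -[X in (_ * X - _)%E]fineK// -/I -!EFinM -EFinB -EFin_expe.
rewrite -[X in (_ <= X)%E -> _]fineK ?integrable_fin_num// lee_fin => le.
rewrite -[X in (_ <= _ * X)%E]fineK ?integrable_fin_num// -EFinM lee_fin mulrC -ler_pdivrMr//.
apply: le_trans le; rewrite le_eqVlt; apply/orP; left; apply/eqP; rewrite /t; field.
by rewrite gt_eqF.
Qed.

End CauchySchwarz.

(** * Growth of the weight along rays *)

Section Growth.
Context {R : realType} {N : nat}.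
Local Notation lambda := (@lebesgue_rV R N).
Local Notation leb := (@lebesgue_measure R).
Implicit Types (u : 'rV[R]_N -> R) (Du : 'rV[R]_N -> 'rV[R]_N).

Lemma measurable_fun_enorm : measurable_fun setT (@enorm R N).
Proof. by apply: measurable_enorm => i; exact: measurable_coord. Qed.

Lemma coord_bounded_on_cube (i : 'I_N) (m : nat) :
  bounded_on_cube m%:R m (fun x : 'rV[R]_N => x ord0 i * \1_(cube m) x).
Proof.
split.
- apply: measurable_funM; first exact: measurable_coord.
  by apply: measurable_indic; exact: measurable_cube.
- move=> x; rewrite indicE; case: (boolP (x \in cube m)) => [/set_mem xm|_].
    by rewrite mulr1; have := xm i; rewrite /= in_itv/= -ltr_norml => /ltW.
  by rewrite mulr0 normr0.
- by move=> x xm; rewrite indicE memNset// mulr0.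
Qed.

Lemma cube_integrable_radial u Du k : weak_gradient u Du ->
  cube_integrable (fun x => dotv x (Du x) - k * u x).
Proof.
move=> [/L1loc_cube_integrable[mu ui] Dui _].
have mDu i : measurable_fun setT (fun x => Du x ord0 i).
  by have [] := L1loc_cube_integrable (Dui i).
split.
  apply: measurable_funB; last exact: measurable_funM.
  by apply: measurable_dotv => // i; exact: measurable_coord.
move=> m; have mc := @measurable_cube R N m.
apply: (@eq_integrable _ _ _ lambda _ mc
    (fun x => (\sum_i (Du x ord0 i * (x ord0 i * \1_(cube m) x))%:E - k%:E * (u x)%:E)%E)).
  move=> x xm; rewrite sumEFin -EFinM -EFinB; congr EFin; congr (_ - _).
  by apply: eq_bigr => i _; rewrite indicE xm mulr1 mulrC.
apply: integrableB => //; last exact: integrableZl.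
apply: integrable_sum => // i _.
apply: (@integrableS _ _ _ lambda setT) => //.
exact: (integrableM_bounded (L1loc_cube_integrable (Dui i)) (coord_bounded_on_cube i m)).
Qed.

(** radial_FTC applied to [u], with a representative of [y . grad u - k u] that is
    nonnegative everywhere on the ball. *)
Lemma weight_growth u Du (k r S : R) : weak_gradient u Du -> 0 < S ->
  {ae lambda, forall y, enorm y < r -> k * u y <= dotv y (Du y)} ->
  {ae lambda, forall x, enorm (expR S *: x) < r ->
    u x <= expR (- k * S) * u (expR S *: x)}.
Proof.
move=> wg S0 mono.
have vi := cube_integrable_radial k wg.
pose v x := dotv x (Du x) - k * u x.
pose w x := if enorm x < r then Num.max 0 (v x) else v x.
have mw : measurable_fun setT w.
  apply: measurable_fun_ifT; last exact: vi.1.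
    by apply: measurable_fun_ltr => //; exact: measurable_fun_enorm.
  by apply: measurable_maxr => //; exact: vi.1.
have wi : cube_integrable w.
  split=> // m; apply: (le_integrable _ _ _ (vi.2 m)); first exact: measurable_cube.
    by apply/measurable_EFinP; exact: measurable_funTS.
  move=> x _; rewrite /= lee_fin /w; case: ifP => // _.
  by rewrite /Num.max; case: ifP => //; rewrite normr0.
have wE : {ae lambda, forall x, w x = dotv x (Du x) - k * u x}.
  apply: filterS mono => y h; rewrite /w; case: ifPn => // yr.
  by apply/max_idPr; rewrite subr_ge0 h.
apply: filterS (radial_FTC wg wi wE S0) => x [_ E] xr.
rewrite -subr_ge0 -lee_fin -E; apply: integral_ge0 => s /=.
rewrite in_itv/= => /andP[s0 sS]; rewrite lee_fin mulr_ge0 ?expR_ge0//.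
rewrite /w ifT; first by rewrite le_max lexx.
apply: le_lt_trans xr; rewrite !enormZ ?expR_ge0// ler_wpM2r ?enorm_ge0//.
by rewrite ler_expR.
Qed.

End Growth.

(** * Hardy's inequality on shells *)

Section HardyPointwise.
Context {R : realType} {N : nat}.
Local Notation lambda := (@lebesgue_rV R N).
Local Notation leb := (@lebesgue_measure R).
Implicit Types (phi mu : 'rV[R]_N -> R) (Dphi : 'rV[R]_N -> 'rV[R]_N).

Definition shell (d p : R) : set 'rV[R]_N := [set x | d <= enorm x < p].

Lemma measurable_shell d p : measurable (shell d p).
Proof.
rewrite (_ : shell d p = @enorm R N @^-1` `[d, p[).
  rewrite -[X in measurable X]setTI; exact: measurable_fun_enorm.
by apply/seteqP; split => x; rewrite /shell /= in_itv.
Qed.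

Lemma measurable_ray_sqr Dphi (b : R) :
  (forall i, measurable_fun setT (fun x => Dphi x ord0 i)) ->
  measurable_fun setT (fun p : 'rV[R]_N * measurableTypeR R =>
    expR (b * p.2) * enorm (Dphi (expR p.2 *: p.1)) ^+ 2).
Proof.
move=> mD; apply: measurable_funM.
  by apply: (measurableT_comp (@measurable_expR R)); exact: measurable_funM.
apply: measurable_funX.
apply: (@measurableT_comp _ _ _ _ _ _ (fun x => enorm (Dphi x)) _
  (fun p : 'rV[R]_N * measurableTypeR R => expR p.2 *: p.1)).
  exact: measurable_enorm.
apply: measurable_scaling => //.
exact: (measurableT_comp (@measurable_expR R)).
Qed.

Lemma sqrB_split (p i t : R) : 0 < t < 1 ->
  (p - i) ^+ 2 <= t^-1 * p ^+ 2 + (1 - t)^-1 * i ^+ 2.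
Proof.
move=> /andP[t0 t1]; have s0 : 0 < 1 - t by rewrite subr_gt0.
rewrite -subr_ge0.
have -> : t^-1 * p ^+ 2 + (1 - t)^-1 * i ^+ 2 - (p - i) ^+ 2 =
  ((1 - t) * p + t * i) ^+ 2 / (t * (1 - t)).
  by field; rewrite !gt_eqF.
by rewrite divr_ge0 ?sqr_ge0// mulr_ge0// ltW.
Qed.

(** sqrB_split with [t = exp (- b)] and the Cauchy-Schwarz inequality with weight
    [exp (- b s)] match: the integral of this weight over [`[0, 1]] is
    [(1 - t) / b], which cancels the factor [1 / (1 - t)]. *)
Lemma hardy_pointwise phi Dphi (b : R) : weak_gradient phi Dphi -> 0 < b ->
  {ae lambda, forall x, ((phi x ^+ 2)%:E <= (expR b * phi (expR 1 *: x) ^+ 2)%:E +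
    (enorm x ^+ 2 / b)%:E * \int[leb]_(s in `[0%R, 1%R])
       (expR ((b + 2) * s) * enorm (Dphi (expR s *: x)) ^+ 2)%:E)%E}.
Proof.
move=> wg b0.
have mD i : measurable_fun setT (fun x => Dphi x ord0 i).
  by have [_ Di _] := wg; have [] := L1loc_cube_integrable (Di i).
have vi := cube_integrable_radial 0 wg.
have wE : {ae lambda, forall x, dotv x (Dphi x) - 0 * phi x = dotv x (Dphi x) - 0 * phi x}.
  exact/aeW.
have b1 : 0 < expR (- b) < 1 by rewrite expR_gt0 -expR0 ltr_expR oppr_lt0.
apply: filterS (radial_FTC wg vi wE (@ltr01 R)) => x [fi E].
pose f (s : R) := expR (- 0 * s) *
  (dotv (expR s *: x) (Dphi (expR s *: x)) - 0 * phi (expR s *: x)).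
have {}fi : leb.-integrable `[0, 1] (fun s => (f s)%:E) := fi.
have {}E : (\int[leb]_(s in `[0%R, 1%R]) (f s)%:E =
  (expR (- 0 * 1) * phi (expR 1 *: x) - phi x)%:E)%E := E.
set Q := (\int[leb]_(s in _) _)%E.
have mq : measurable_fun setT (fun s => (expR ((b + 2) * s) * enorm (Dphi (expR s *: x)) ^+ 2)%:E).
  by apply/measurable_EFinP; exact: (measurableT_comp (measurable_ray_sqr (b + 2) mD) (measurable_pair1 x)).
have CS := weighted_cauchy_schwarz b0 ltr01 fi.
rewrite E oppr0 mul0r expR0 mul1r mulr1 -EFin_expe in CS.
have le : (\int[leb]_(s in `[0%R, 1%R]) (expR (b * s) * f s ^+ 2)%:E <= (enorm x ^+ 2)%:E * Q)%E.
  rewrite -ge0_integralZl//; last 3 first.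
  - exact: measurable_funTS.
  - by move=> s _; rewrite lee_fin mulr_ge0 ?expR_ge0 ?sqr_ge0.
  - by rewrite lee_fin sqr_ge0.
  apply: ge0_le_integral => //.
  - by move=> s _; rewrite lee_fin mulr_ge0 ?expR_ge0 ?sqr_ge0.
  - apply/measurable_EFinP; apply: measurable_funM.
      apply: measurable_funTS; apply: (measurableT_comp (@measurable_expR R)).
      exact: measurable_funM.
    by apply: measurable_funX; apply/measurable_EFinP; exact: measurable_int fi.
  - by apply: emeasurable_funM => //; exact: measurable_funTS.
  - move=> s _; rewrite -EFinM lee_fin /f oppr0 !mul0r expR0 mul1r subr0.
    have := dotv_sqr_le (expR s *: x) (Dphi (expR s *: x)).
    rewrite -!enorm_sqr enormZ ?expR_ge0// => /(ler_wpM2l (expR_ge0 (b * s)))/le_trans; apply.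
    rewrite (_ : (b + 2) * s = b * s + s + s); last by ring.
    by rewrite !expRD le_eqVlt; apply/orP; left; apply/eqP; ring.
have := sqrB_split (phi (expR 1 *: x)) (phi (expR 1 *: x) - phi x) b1.
rewrite opprB addrC subrK -lee_fin => /le_trans; apply.
rewrite -expRN opprK EFinD leeD2l// EFinM.
apply: (@le_trans _ _ (((1 - expR (- b))^-1)%:E * (((1 - expR (- b)) / b)%:E * ((enorm x ^+ 2)%:E * Q)))%E).
  rewrite lee_wpmul2l// ?lee_fin ?invr_ge0 ?subr_ge0; first by have /andP[_ /ltW] := b1.
  apply: le_trans CS _; rewrite lee_wpmul2l// lee_fin divr_ge0// ?ltW// subr_gt0.
  by have /andP[] := b1.
rewrite !muleA -!EFinM le_eqVlt; apply/orP; left; apply/eqP; congr (_ %:E * _)%E.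
by field; rewrite !gt_eqF// subr_gt0; have /andP[] := b1.
Qed.

End HardyPointwise.

Section HardyOnShells.
Context {R : realType} {N : nat}.
Local Notation lambda := (@lebesgue_rV R N).
Local Notation leb := (@lebesgue_measure R).
Implicit Types (phi mu : 'rV[R]_N -> R) (Dphi : 'rV[R]_N -> 'rV[R]_N).

Definition dilation_growth mu (k r : R) := forall s, 0 < s ->
  {ae lambda, forall x, enorm (expR s *: x) < r ->
    mu x <= expR (- k * s) * mu (expR s *: x)}.

Section Shell.
Variables (mu phi : 'rV[R]_N -> R) (Dphi : 'rV[R]_N -> 'rV[R]_N) (k r d p b nphi nD : R).
Hypotheses (mu_ge0 : forall x, 0 <= mu x) (mmu : measurable_fun setT mu).
Hypotheses (mphi : measurable_fun setT phi)
  (mDphi : forall i, measurable_fun setT (fun x => Dphi x ord0 i)).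
Hypotheses (growth : dilation_growth mu k r) (d0 : 0 < d) (p0 : 0 < p) (pr : expR 1 * p <= r).
Hypotheses (b0 : 0 < b) (bE : N%:R + k = 2 * (b + 1)).
Hypothesis (phiE : (\int[lambda]_x (phi x ^+ 2 * mu x)%:E = nphi%:E)%E).
Hypothesis (DphiE : (\int[lambda]_x (enorm (Dphi x) ^+ 2 * mu x)%:E = nD%:E)%E).

Definition hardy_density (x : 'rV[R]_N) := phi x ^+ 2 / enorm x ^+ 2 * mu x.

Lemma hardy_density_ge0 x : 0 <= hardy_density x.
Proof. by rewrite mulr_ge0// mulr_ge0 ?invr_ge0 ?sqr_ge0. Qed.

Lemma measurable_inv_sqr_norm : measurable_fun setT (fun x : 'rV[R]_N => (enorm x ^+ 2)^-1).
Proof.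
rewrite (_ : (fun x => _) = fun x => (enorm x ^+ 2) `^ (- 1)); last first.
  by apply/funext => x; rewrite powR_inv1 ?sqr_ge0.
apply: (measurableT_comp (measurable_powR (- 1))).
by apply: measurable_funX; exact: measurable_fun_enorm.
Qed.

Lemma measurable_hardy_density : measurable_fun setT hardy_density.
Proof.
apply: measurable_funM => //; apply: measurable_funM; first exact: measurable_funX.
exact: measurable_inv_sqr_norm.
Qed.

Lemma hardy_density_le (c : R) x : 0 < c -> c <= enorm x ->
  hardy_density x <= phi x ^+ 2 * mu x / c ^+ 2.
Proof.
move=> c0 cx; rewrite /hardy_density mulrAC.
apply: ler_wpM2l; first by rewrite mulr_ge0 ?sqr_ge0.
have x0 := lt_le_trans c0 cx.
rewrite lef_pV2 ?posrE ?exprn_gt0//.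
by rewrite lerXn2r ?nnegrE// ltW.
Qed.

Lemma mass_ge0 c x : 0 <= phi x ^+ 2 * mu x / c ^+ 2.
Proof. exact: divr_ge0 (mulr_ge0 (sqr_ge0 _) (mu_ge0 x)) (sqr_ge0 _). Qed.

Lemma dilated_mass_ge0 x y :
  0 <= expR b * phi y ^+ 2 * ((enorm x ^+ 2)^-1 * mu x).
Proof.
have xx : 0 <= (enorm x ^+ 2)^-1 by rewrite invr_ge0 sqr_ge0.
exact: mulr_ge0 (mulr_ge0 (expR_ge0 _) (sqr_ge0 _)) (mulr_ge0 xx (mu_ge0 x)).
Qed.

Lemma scaled_mass (c : R) : (\int[lambda]_x (phi x ^+ 2 * mu x / c)%:E = (nphi / c)%:E)%E.
Proof.
have i : lambda.-integrable setT (fun x => (phi x ^+ 2 * mu x)%:E).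
  apply/integrableP; split.
    by apply/measurable_EFinP; apply: measurable_funM => //; exact: measurable_funX.
  rewrite (eq_integral (fun x => (phi x ^+ 2 * mu x)%:E)) ?phiE ?ltry// => x _.
  by rewrite gee0_abs// lee_fin mulr_ge0 ?sqr_ge0.
under eq_integral do rewrite mulrC EFinM.
by rewrite integralZl// phiE -EFinM mulrC.
Qed.

(** Finiteness is what allows [t A] to be absorbed in hardy_shell. *)
Lemma shell_finite : exists A : R,
  (\int[lambda]_(x in shell d p) (hardy_density x)%:E = A%:E)%E.
Proof.
exists (fine (\int[lambda]_(x in shell d p) (hardy_density x)%:E)%E).
rewrite fineK// ge0_fin_numE; last first.
  by apply: integral_ge0 => x _; rewrite lee_fin hardy_density_ge0.
apply: (@le_lt_trans _ _ (nphi / d ^+ 2)%:E); last exact: ltry.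
rewrite -scaled_mass; apply: (@le_trans _ _ (\int[lambda]_(x in shell d p) (phi x ^+ 2 * mu x / d ^+ 2)%:E)%E).
  apply: ge0_le_integral => //.
  - exact: measurable_shell.
  - by move=> x _; rewrite lee_fin hardy_density_ge0.
  - by apply/measurable_EFinP/measurable_funTS; exact: measurable_hardy_density.
  - apply/measurable_EFinP/measurable_funTS; apply: measurable_funM => //.
    by apply: measurable_funM => //; exact: measurable_funX.
  - by move=> x /andP[dx _]; rewrite lee_fin hardy_density_le.
apply: ge0_subset_integral => //.
- exact: measurable_shell.
- apply/measurable_EFinP; apply: measurable_funM => //.
  by apply: measurable_funM => //; exact: measurable_funX.
- by move=> x _; rewrite lee_fin mass_ge0.
Qed.

(** The substitution [y = e x] produces the factor [exp (b + 2 - k - N)], that is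
    [exp (- b)], and moves the shell outwards: what leaves it is at distance at
    least [p] from the origin. *)
Lemma dilated_mass_le (A : R) :
  (\int[lambda]_(x in shell d p) (hardy_density x)%:E = A%:E)%E ->
  (\int[lambda]_(x in shell d p)
     (expR b * phi (expR 1 *: x) ^+ 2 * ((enorm x ^+ 2)^-1 * mu x))%:E
   <= (expR (- b) * (A + nphi / p ^+ 2))%:E)%E.
Proof.
move=> AE.
have mh : measurable_fun setT hardy_density := measurable_hardy_density.
pose Q (y : 'rV[R]_N) := (hardy_density y * \1_(shell (expR 1 * d) (expR 1 * p)) y)%:E.
have Q0 y : (0 <= Q y)%E.
  by rewrite lee_fin mulr_ge0 ?hardy_density_ge0// indicE; case: (_ \in _).
have mQ : measurable_fun setT Q.
  apply/measurable_EFinP; apply: measurable_funM => //.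
  by apply: measurable_indic; exact: measurable_shell.
have QA : (\int[lambda]_y Q y <= (A + nphi / p ^+ 2)%:E)%E.
  rewrite EFinD -AE -scaled_mass [X in (X + _)%E]integral_mkcond -ge0_integralD//; first last.
  - apply/measurable_EFinP; apply: measurable_funM => //.
    by apply: measurable_funM => //; exact: measurable_funX.
  - by move=> x _; rewrite lee_fin mass_ge0.
  - apply/(measurable_restrictT _ _).1; first exact: measurable_shell.
    by apply/measurable_EFinP/measurable_funTS.
  - by move=> x _; rewrite patchE; case: ifP => // _; rewrite lee_fin hardy_density_ge0.
  apply: ge0_le_integral => //.
  - apply: emeasurable_funD.
      apply/(measurable_restrictT _ _).1; first exact: measurable_shell.
      by apply/measurable_EFinP/measurable_funTS.
    apply/measurable_EFinP; apply: measurable_funM => //.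
    by apply: measurable_funM => //; exact: measurable_funX.
  - move=> x _; rewrite /Q indicE patchE.
    have mass0 := mass_ge0 p x.
    case: (boolP (x \in shell (expR 1 * d) _)) => [/set_mem/andP[dx xp]|_]; last first.
      rewrite mulr0; case: ifP => _; last by rewrite add0e.
      by rewrite -EFinD lee_fin addr_ge0// hardy_density_ge0.
    rewrite mulr1; case: ifPn => [_|xnp].
      by rewrite -EFinD lee_fin lerDl.
    rewrite add0e lee_fin hardy_density_le// leNgt; apply: contra xnp => xp'.
    rewrite mem_set// /shell/= xp' andbT (le_trans _ dx)//.
    by rewrite ler_peMl ?(ltW d0)// -expR0 ler_expR.
apply: (@le_trans _ _ (\int[lambda]_x ((expR (b + 2 - k))%:E * Q (expR 1 *: x)))%E).
  rewrite [leLHS]integral_mkcond; apply: ae_ge0_le_integral => //.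
  - by move=> x _; rewrite patchE; case: ifP => // _;
      rewrite lee_fin dilated_mass_ge0.
  - apply/(measurable_restrictT _ _).1; first exact: measurable_shell.
    apply/measurable_EFinP/measurable_funTS; apply: measurable_funM.
      apply: measurable_funM => //; apply: measurable_funX.
      exact: (measurableT_comp mphi (@measurable_dilation R N _)).
    by apply: measurable_funM => //; exact: measurable_inv_sqr_norm.
  - by move=> x _; rewrite mule_ge0// lee_fin expR_ge0.
  - by apply: emeasurable_funM => //; exact: (measurableT_comp mQ (@measurable_dilation R N _)).
  - apply: filterS (growth ltr01) => x gx _; rewrite patchE.
    case: ifPn => [/set_mem/andP[dx xp]|_]; last by rewrite mule_ge0// lee_fin expR_ge0.
    have x0 := lt_le_trans d0 dx.
    rewrite /Q -EFinM lee_fin indicE mem_set ?mulr1; last first.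
      by rewrite /shell/= enormZ ?expR_ge0// ler_pM2l ?expR_gt0// dx ltr_pM2l ?expR_gt0.
    have {}gx : mu x <= expR (- k) * mu (expR 1 *: x).
      have := gx; rewrite mulr1; apply.
      by rewrite enormZ ?expR_ge0// (lt_le_trans _ pr)// ltr_pM2l ?expR_gt0.
    apply: (@le_trans _ _ (expR b * phi (expR 1 *: x) ^+ 2 *
        ((enorm x ^+ 2)^-1 * (expR (- k) * mu (expR 1 *: x))))).
      apply: ler_wpM2l; first exact: mulr_ge0 (expR_ge0 _) (sqr_ge0 _).
      by apply: ler_wpM2l => //; rewrite invr_ge0 sqr_ge0.
    rewrite /hardy_density enormZ ?expR_ge0//.
    rewrite (_ : b + 2 - k = b + 1 + 1 + - k); last by ring.
    rewrite !expRD le_eqVlt; apply/orP; left; apply/eqP; field.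
    by rewrite !gt_eqF ?expR_gt0.
rewrite ge0_integralZl//; last first.
  exact: (measurableT_comp mQ (@measurable_dilation R N _)).
rewrite (ge0_integral_dilation (expR_gt0 1) mQ Q0) muleA -EFinM.
apply: (@le_trans _ _ ((expR (b + 2 - k) * expR 1 ^- N)%:E * (A + nphi / p ^+ 2)%:E)%E).
  by rewrite lee_wpmul2l// lee_fin mulr_ge0 ?expR_ge0// invr_ge0 exprn_ge0// expR_ge0.
rewrite -EFinM lee_fin.
have -> : expR (1 : R) ^- N = expR (- (N%:R * 1)) by rewrite expRN expRM_natl.
rewrite -expRD (_ : b + 2 - k + - (N%:R * 1) = - b)//.
by move: bE; lra.
Qed.

(** For fixed [s] the substitution [y = exp s x] produces the factor
    [exp ((b + 2 - k - N) s)], that is [exp (- b s)], to be integrated over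
    [`[0, 1]]. *)
Lemma dilated_energy_le :
  (\int[lambda]_(x in shell d p) ((b^-1 * mu x)%:E *
     \int[leb]_(s in `[0%R, 1%R]) (expR ((b + 2) * s) * enorm (Dphi (expR s *: x)) ^+ 2)%:E)
   <= ((1 - expR (- b)) / b ^+ 2 * nD)%:E)%E.
Proof.
pose H (q : 'rV[R]_N * measurableTypeR R) : \bar R :=
  (\1_(shell d p) q.1 * \1_`[0, 1] q.2 * (b^-1 * mu q.1 *
    (expR ((b + 2) * q.2) * enorm (Dphi (expR q.2 *: q.1)) ^+ 2)))%:E.
have E0 s x : 0 <= expR ((b + 2) * s) * enorm (Dphi (expR s *: x)) ^+ 2.
  exact: mulr_ge0 (expR_ge0 _) (sqr_ge0 _).
have bm0 x : 0 <= b^-1 * mu x by rewrite mulr_ge0// invr_ge0 ltW.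
have H0 q : (0 <= H q)%E.
  rewrite lee_fin; apply: mulr_ge0; last exact: mulr_ge0.
  by rewrite mulr_ge0// indicE; case: (_ \in _).
have mE := measurable_ray_sqr (b + 2) mDphi.
have mH : measurable_fun setT H.
  apply/measurable_EFinP; apply: measurable_funM.
    apply: measurable_funM.
      apply: (@measurableT_comp _ _ _ _ _ _ (\1_(shell d p) : 'rV[R]_N -> R) _ fst) => //.
      by apply: measurable_indic; exact: measurable_shell.
    by apply: (@measurableT_comp _ _ _ _ _ _ (\1_`[0, 1] : measurableTypeR R -> R) _ snd).
  apply: measurable_funM => //; apply: measurable_funM => //.
  exact: (measurableT_comp mmu measurable_fst).
rewrite (_ : (\int[lambda]_(x in _) _)%E = (\int[lambda]_x \int[leb]_s H (x, s))%E); last first.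
  rewrite integral_mkcond; apply: eq_integral => x _; rewrite patchE.
  case: ifPn => [xs|xs]; last first.
    rewrite integral0_eq// => s _; rewrite /H/= indicE (negPf xs) !mul0r//.
  rewrite -ge0_integralZl//; last 3 first.
  - apply/measurable_EFinP; apply: measurable_funTS.
    exact: (measurableT_comp mE (measurable_pair1 x)).
  - by move=> s _; rewrite lee_fin.
  - by rewrite lee_fin.
  rewrite integral_mkcond; apply: eq_integral => s _.
  rewrite patchE /H/= !indicE xs mul1r.
  by case: (_ \in _); rewrite ?mul1r ?mul0r// EFinM.
rewrite (fubini_tonelli _ mH H0).
have nD0 : 0 <= nD.
  rewrite -lee_fin -DphiE; apply: integral_ge0 => x _.
  by rewrite lee_fin mulr_ge0 ?sqr_ge0.
pose c s := b^-1 * nD * expR (- b * s).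
have c0 s : 0 <= c s.
  by apply: mulr_ge0; [rewrite mulr_ge0// invr_ge0 ltW|exact: expR_ge0].
have mc : measurable_fun setT (fun s => (c s)%:E).
  apply/measurable_EFinP; apply: measurable_funM => //.
  by apply: (measurableT_comp (@measurable_expR R)); exact: measurable_funM.
apply: (@le_trans _ _ (\int[leb]_(s in `[0%R, 1%R]) (c s)%:E)%E); last first.
  rewrite /c; under eq_integral do rewrite EFinM.
  rewrite ge0_integralZl//; last 2 first.
  - apply/measurable_EFinP; apply: measurable_funTS.
    by apply: (measurableT_comp (@measurable_expR R)); exact: measurable_funM.
  - by rewrite lee_fin mulr_ge0// invr_ge0 ltW.
  rewrite integral_expR ?gt_eqF// mulr1 -EFinM lee_fin le_eqVlt; apply/orP; left.
  by apply/eqP; field; rewrite gt_eqF.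
rewrite [leRHS]integral_mkcond; apply: ge0_le_integral => //.
- by move=> s _; apply: integral_ge0.
- exact: (measurable_fun_fubini_tonelli_G H).
- by apply/(measurable_restrictT _ _).1 => //; exact: measurable_funTS.
move=> s _; rewrite patchE mem_setE in_itv/=; case: ifPn => [/andP[s0 s1]|ns]; last first.
  rewrite integral0_eq// => x _; rewrite /H/= [\1__ s]indicE mem_setE in_itv/= (negPf ns).
  by rewrite mulr0 mul0r.
pose D2 (y : 'rV[R]_N) := (enorm (Dphi y) ^+ 2 * mu y)%:E.
have mD2 : measurable_fun setT D2.
  apply/measurable_EFinP; apply: measurable_funM => //; apply: measurable_funX.
  exact: measurable_enorm.
have D20 y : (0 <= D2 y)%E by rewrite lee_fin mulr_ge0 ?sqr_ge0.
apply: (@le_trans _ _ (\int[lambda]_x ((b^-1 * expR ((b + 2 - k) * s))%:E * D2 (expR s *: x)))%E).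
  apply: ae_ge0_le_integral => //.
  - exact: (measurableT_comp mH (measurable_pair2 s)).
  - move=> x _; apply: mule_ge0 => //; rewrite lee_fin mulr_ge0 ?expR_ge0//.
    by rewrite invr_ge0 ltW.
  - by apply: emeasurable_funM => //; exact: (measurableT_comp mD2 (@measurable_dilation R N _)).
  have gs : {ae lambda, forall x, enorm (expR s *: x) < r -> mu x <= expR (- k * s) * mu (expR s *: x)}.
    move: s0; rewrite le_eqVlt => /orP[/eqP <-|]; last exact: growth.
    by apply/aeW => x _; rewrite mulr0 expR0 mul1r scale1r.
  apply: filterS gs => x gx _; rewrite /H/= -EFinM lee_fin.
  have rhs0 : 0 <= b^-1 * expR ((b + 2 - k) * s) * (enorm (Dphi (expR s *: x)) ^+ 2 * mu (expR s *: x)).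
    apply: mulr_ge0; last exact: mulr_ge0 (sqr_ge0 _) (mu_ge0 _).
    by rewrite mulr_ge0 ?expR_ge0// invr_ge0 ltW.
  rewrite indicE; case: (boolP (x \in shell d p)) => [/set_mem/andP[dx xp]|_]; last by rewrite !mul0r.
  rewrite mul1r [\1__ s]indicE mem_setE in_itv/= s0 s1 mul1r.
  have {}gx : mu x <= expR (- k * s) * mu (expR s *: x).
    apply: gx; rewrite enormZ ?expR_ge0//.
    apply: (@le_lt_trans _ _ (expR 1 * enorm x)).
      by rewrite ler_wpM2r ?enorm_ge0// ler_expR.
    by rewrite (lt_le_trans _ pr)// ltr_pM2l ?expR_gt0.
  apply: (@le_trans _ _ (b^-1 * (expR (- k * s) * mu (expR s *: x)) *
      (expR ((b + 2) * s) * enorm (Dphi (expR s *: x)) ^+ 2))).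
    by apply: ler_wpM2r => //; apply: ler_wpM2l => //; rewrite invr_ge0 ltW.
  rewrite (_ : (b + 2 - k) * s = (b + 2) * s + - k * s); last by ring.
  by rewrite !expRD le_eqVlt; apply/orP; left; apply/eqP; ring.
rewrite ge0_integralZl//; last 2 first.
- exact: (measurableT_comp mD2 (@measurable_dilation R N _)).
- by rewrite lee_fin mulr_ge0 ?expR_ge0// invr_ge0 ltW.
rewrite (ge0_integral_dilation (expR_gt0 s) mD2 D20) /D2 DphiE -!EFinM lee_fin /c.
have -> : expR s ^- N = expR (- (N%:R * s)) by rewrite expRN expRM_natl.
rewrite mulrA -[_ * expR _ * expR _]mulrA -expRD.
rewrite (_ : (b + 2 - k) * s + - (N%:R * s) = - b * s); last first.
  have kE : k = 2 * (b + 1) - N%:R by rewrite -bE; ring.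
  by rewrite kE; ring.
by rewrite le_eqVlt; apply/orP; left; apply/eqP; ring.
Qed.

(** dilated_mass_le and dilated_energy_le bound [A] by [t A] plus [1 - t] times the
    right-hand side; [A] being finite, [t A] can be absorbed. *)
Lemma hardy_shell : weak_gradient phi Dphi ->
  (\int[lambda]_(x in shell d p) (hardy_density x)%:E <=
   (nD / b ^+ 2 + expR (- b) / (1 - expR (- b)) * (nphi / p ^+ 2))%:E)%E.
Proof.
move=> wg; have [A AE] := shell_finite.
have t1 : 0 < 1 - expR (- b) by rewrite subr_gt0 -expR0 ltr_expR oppr_lt0.
have mE := measurable_ray_sqr (b + 2) mDphi.
have E0 s x : 0 <= expR ((b + 2) * s) * enorm (Dphi (expR s *: x)) ^+ 2.
  exact: mulr_ge0 (expR_ge0 _) (sqr_ge0 _).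
have bm0 x : 0 <= b^-1 * mu x by rewrite mulr_ge0// invr_ge0 ltW.
have mray : measurable_fun setT (fun x : 'rV[R]_N => (\int[leb]_(s in `[0%R, 1%R])
    (expR ((b + 2) * s) * enorm (Dphi (expR s *: x)) ^+ 2)%:E)%E).
  pose G (q : 'rV[R]_N * measurableTypeR R) : \bar R := (\1_`[0, 1] q.2 *
    (expR ((b + 2) * q.2) * enorm (Dphi (expR q.2 *: q.1)) ^+ 2))%:E.
  rewrite (_ : (fun x => _) = fun x => (\int[leb]_s G (x, s))%E); last first.
    apply/funext => x; rewrite integral_mkcond; apply: eq_integral => s _.
    by rewrite patchE /G/= indicE; case: (_ \in _); rewrite ?mul1r ?mul0r.
  apply: (measurable_fun_fubini_tonelli_F G).
    apply/measurable_EFinP; apply: measurable_funM => //.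
    by apply: (@measurableT_comp _ _ _ _ _ _ (\1_`[0, 1] : measurableTypeR R -> R) _ snd).
  move=> q; rewrite lee_fin; apply: mulr_ge0; last exact: E0.
  by rewrite indicE; case: (_ \in _).
have ray0 (x : 'rV[R]_N) : (0 <= \int[leb]_(s in `[0%R, 1%R])
    (expR ((b + 2) * s) * enorm (Dphi (expR s *: x)) ^+ 2)%:E)%E.
  by apply: integral_ge0 => s _; rewrite lee_fin.
have mbm : measurable_fun setT (fun x => (b^-1 * mu x)%:E).
  by apply/measurable_EFinP; exact: measurable_funM.
have mdil : measurable_fun setT (fun x : 'rV[R]_N =>
    (expR b * phi (expR 1 *: x) ^+ 2 * ((enorm x ^+ 2)^-1 * mu x))%:E).
  apply/measurable_EFinP; apply: measurable_funM.
    apply: measurable_funM => //; apply: measurable_funX.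
    exact: (measurableT_comp mphi (@measurable_dilation R N _)).
  by apply: measurable_funM => //; exact: measurable_inv_sqr_norm.
have le : (A%:E <= (expR (- b) * (A + nphi / p ^+ 2))%:E + ((1 - expR (- b)) / b ^+ 2 * nD)%:E)%E.
  rewrite -{1}AE; apply: le_trans (leeD (dilated_mass_le AE) dilated_energy_le).
  have ms := @measurable_shell R N d p.
  rewrite -ge0_integralD//; first last.
  - by apply: emeasurable_funM; exact: measurable_funTS.
  - by move=> x _; apply: mule_ge0 => //; rewrite lee_fin.
  - exact: measurable_funTS.
  - by move=> x _; rewrite lee_fin dilated_mass_ge0.
  apply: ae_ge0_le_integral => //.
  - by move=> x _; rewrite lee_fin hardy_density_ge0.
  - by apply/measurable_EFinP/measurable_funTS; exact: measurable_hardy_density.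
  - move=> x _; apply: adde_ge0; first by rewrite lee_fin dilated_mass_ge0.
    by apply: mule_ge0 => //; rewrite lee_fin.
  - apply: emeasurable_funD; first exact: measurable_funTS.
    by apply: emeasurable_funM; exact: measurable_funTS.
  - apply: filterS (hardy_pointwise wg b0) => x hx /andP[dx xp].
    have x0 := lt_le_trans d0 dx.
    have c0 : 0 <= (enorm x ^+ 2)^-1 * mu x by rewrite mulr_ge0// invr_ge0 sqr_ge0.
    rewrite (_ : (hardy_density x)%:E = ((enorm x ^+ 2)^-1 * mu x)%:E * (phi x ^+ 2)%:E)%E; last first.
      by rewrite -EFinM /hardy_density; congr EFin; ring.
    apply: (@le_trans _ _ _ _ _ (lee_wpmul2l _ hx)); first by rewrite lee_fin.
    rewrite ge0_muleDr ?lee_fin//; last 2 first.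
    + exact: mulr_ge0 (expR_ge0 _) (sqr_ge0 _).
    + by apply: mule_ge0 => //; rewrite lee_fin divr_ge0 ?sqr_ge0// ltW.
    rewrite muleA -!EFinM le_eqVlt; apply/orP; left; apply/eqP; congr (_ %:E + _ %:E * _)%E.
      by ring.
    by field; rewrite !gt_eqF.
rewrite AE lee_fin; move: le; rewrite -EFinD lee_fin => le.
rewrite -(ler_pM2l t1) mulrDr.
have -> : (1 - expR (- b)) * (expR (- b) / (1 - expR (- b)) * (nphi / p ^+ 2)) =
   expR (- b) * (nphi / p ^+ 2) by field; rewrite gt_eqF//= gt_eqF.
have -> : (1 - expR (- b)) * (nD / b ^+ 2) = (1 - expR (- b)) / b ^+ 2 * nD.
  by field; rewrite gt_eqF.
by move: le; lra.
Qed.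

End Shell.
End HardyOnShells.

(** * Exhaustion by shells *)

Section Limits.
Context {R : realType} {N : nat}.
Local Notation lambda := (@lebesgue_rV R N).
Implicit Types (phi mu : 'rV[R]_N -> R) (Dphi : 'rV[R]_N -> 'rV[R]_N).

Lemma integral_exhaustion_le (q : 'rV[R]_N -> R) (D : set 'rV[R]_N)
    (E : nat -> set 'rV[R]_N) (B : R) :
  measurable D -> (forall n, measurable (E n)) -> nondecreasing_seq E ->
  measurable_fun setT q -> (forall x, 0 <= q x) ->
  (forall n, E n `<=` D) -> (forall x, D x -> 0 < q x -> exists n, E n x) ->
  (forall n, \int[lambda]_(x in E n) (q x)%:E <= B%:E)%E ->
  (\int[lambda]_(x in D) (q x)%:E <= B%:E)%E.
Proof.
move=> mD mE ndE mq q0 ED DE EB.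
have -> : (\int[lambda]_(x in D) (q x)%:E = \int[lambda]_(x in \bigcup_n E n) (q x)%:E)%E.
  rewrite [LHS]integral_mkcond [RHS]integral_mkcond; apply: eq_integral => x _.
  rewrite !patchE; case: (boolP (x \in \bigcup_n E n)) => [/set_mem [n _ /ED xD]|xE].
    by rewrite mem_set.
  case: ifPn => // /set_mem xD; congr EFin; apply/eqP; rewrite eq_le q0 andbT leNgt.
  apply: contra xE => /(DE _ xD)[n xn]; rewrite mem_set//; by exists n.
have mqE : measurable_fun setT (fun x => (q x)%:E) by exact/measurable_EFinP.
have cv := @ge0_nondecreasing_set_cvg_integral _ _ R E (fun x => (q x)%:E) lambda ndE mE
  (fun i => measurable_funTS mqE) (fun i x _ => q0 x).
rewrite -(cvg_lim _ cv)//; apply: lime_le.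
  by apply/cvg_ex; exists (\int[lambda]_(x in \bigcup_n E n) (q x)%:E)%E.
exact: nearW.
Qed.

Lemma enorm_shell_mem (x : 'rV[R]_N) : 0 < enorm x -> exists n, n.+1%:R^-1 <= enorm x.
Proof.
move=> x0; exists (Num.bound (enorm x)^-1).
rewrite -[leRHS]invrK lef_pV2 ?posrE ?invr_gt0//.
have := archi_boundP (_ : 0 <= (enorm x)^-1); rewrite invr_ge0 (ltW x0) => /(_ isT)/ltW/le_trans; apply.
by rewrite ler_nat.
Qed.

Lemma hardy_density_gt0 mu phi x : 0 < hardy_density mu phi x -> 0 < enorm x.
Proof.
move=> h; rewrite lt_def enorm_ge0 andbT; apply/eqP => x0; move: h.
by rewrite /hardy_density x0 expr0n/= invr0 mulr0 mul0r ltxx.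
Qed.

Lemma le0_of_le_harmonic (c C : R) : (forall n, c <= C / n.+1%:R) -> c <= 0.
Proof.
move=> h; rewrite leNgt; apply/negP => c0.
have C0 : 0 < C by have := lt_le_trans c0 (h 0%N); rewrite divr1.
have := h (Num.bound (C / c)); rewrite leNgt => /negP; apply.
rewrite ltr_pdivrMr// mulrC -ltr_pdivrMr//.
apply: (lt_trans (archi_boundP _)); first by rewrite divr_ge0// ltW.
by rewrite ltr_nat.
Qed.

Section Exhaustion.
Variables (mu phi : 'rV[R]_N -> R) (Dphi : 'rV[R]_N -> 'rV[R]_N) (k b nphi nD : R).
Hypotheses (mu_ge0 : forall x, 0 <= mu x) (mmu : measurable_fun setT mu).
Hypotheses (mphi : measurable_fun setT phi)
  (mDphi : forall i, measurable_fun setT (fun x => Dphi x ord0 i)).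
Hypotheses (b0 : 0 < b) (bE : N%:R + k = 2 * (b + 1)).
Hypothesis (phiE : (\int[lambda]_x (phi x ^+ 2 * mu x)%:E = nphi%:E)%E).
Hypothesis (DphiE : (\int[lambda]_x (enorm (Dphi x) ^+ 2 * mu x)%:E = nD%:E)%E).
Hypothesis wg : weak_gradient phi Dphi.

Let q := hardy_density mu phi.
Let q0 x : 0 <= q x. Proof. exact: hardy_density_ge0. Qed.
Let mq : measurable_fun setT q. Proof. exact: measurable_hardy_density. Qed.
Let nphi_ge0 : 0 <= nphi.
Proof.
rewrite -lee_fin -phiE; apply: integral_ge0 => x _.
by rewrite lee_fin mulr_ge0 ?sqr_ge0.
Qed.
Let t := expR (- b) / (1 - expR (- b)).
Let t_ge0 : 0 <= t.
Proof. by rewrite divr_ge0 ?expR_ge0// subr_ge0 -expR0 ler_expR oppr_le0 ltW. Qed.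

Lemma hardy_near_origin (r p : R) : dilation_growth mu k r -> 0 < p -> expR 1 * p <= r ->
  (\int[lambda]_x (q x)%:E <= (nD / b ^+ 2 + (t + 1) * (nphi / p ^+ 2))%:E)%E.
Proof.
move=> growth p0 pr.
pose D := [set x : 'rV[R]_N | enorm x < p].
have mD : measurable D.
  rewrite (_ : D = @enorm R N @^-1` `]-oo, p[); last by apply/seteqP; split => x; rewrite /D/= in_itv.
  by rewrite -[X in measurable X]setTI; exact: measurable_fun_enorm.
have mqE : measurable_fun setT (fun x => (q x)%:E) by exact/measurable_EFinP.
have near : (\int[lambda]_(x in D) (q x)%:E <= (nD / b ^+ 2 + t * (nphi / p ^+ 2))%:E)%E.
  apply: (@integral_exhaustion_le _ _ (fun n => shell n.+1%:R^-1 p)) => //.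
  - by move=> n; exact: measurable_shell.
  - move=> m n mn; apply/subsetPset => x /andP[mx xp]; rewrite /shell/= xp andbT.
    by rewrite (le_trans _ mx)// lef_pV2 ?posrE// ler_nat ltnS.
  - by move=> n x /andP[].
  - move=> x xD /hardy_density_gt0/enorm_shell_mem[n xn]; exists n.
    by rewrite /shell/= xn.
  - by move=> n; apply: (hardy_shell mu_ge0 mmu mphi mDphi growth _ p0 pr b0 bE phiE DphiE wg).
have far : (\int[lambda]_(x in ~` D) (q x)%:E <= (nphi / p ^+ 2)%:E)%E.
  rewrite -(scaled_mass mu_ge0 mmu mphi phiE).
  rewrite integral_mkcond; apply: ge0_le_integral => //.
  - by move=> x _; rewrite patchE; case: ifP => // _; rewrite lee_fin.
  - apply/(measurable_restrictT _ _).1; first exact: measurableC.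
    exact: measurable_funTS.
  - apply/measurable_EFinP; apply: measurable_funM => //.
    by apply: measurable_funM => //; exact: measurable_funX.
  - move=> x _; rewrite patchE; case: ifPn => [/set_mem/negP|_]; last first.
      by rewrite lee_fin; exact: mass_ge0.
    by rewrite -leNgt lee_fin => px; exact: hardy_density_le.
have mqDC : measurable_fun (D `|` ~` D) (fun x => (q x)%:E) by exact: measurable_funTS.
have dDC : [disjoint D & ~` D] by exact/disj_setPCl.
have := integral_setU lambda mD (measurableC mD) mqDC dDC.
rewrite setUv => ->.
have -> : nD / b ^+ 2 + (t + 1) * (nphi / p ^+ 2) =
  (nD / b ^+ 2 + t * (nphi / p ^+ 2)) + nphi / p ^+ 2 by ring.
by rewrite EFinD; exact: leeD.
Qed.

(** Exhaust by the shells [1 / (n + 1) <= |x| < m + n + 1]: their boundary terms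
    are bounded by that of radius [m + 1], which vanishes as [m] tends to [+oo]. *)
Lemma hardy_global : (forall r, dilation_growth mu k r) ->
  ((b ^+ 2)%:E * \int[lambda]_x (q x)%:E <= nD%:E)%E.
Proof.
move=> growth.
have le m : (\int[lambda]_x (q x)%:E <= (nD / b ^+ 2 + t * (nphi / m.+1%:R ^+ 2))%:E)%E.
  apply: (@integral_exhaustion_le _ _ (fun n => shell n.+1%:R^-1 (m + n).+1%:R)) => //.
  - by move=> n; exact: measurable_shell.
  - move=> i j ij; apply/subsetPset => x /andP[mx xp]; apply/andP; split.
      by rewrite (le_trans _ mx)// lef_pV2 ?posrE// ler_nat ltnS.
    by rewrite (lt_le_trans xp)// ler_nat ltnS leq_add2l.
  - move=> x _ /hardy_density_gt0/enorm_shell_mem[n xn].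
    have := archi_boundP (enorm_ge0 x); set l := Num.bound _ => xl.
    exists (maxn n l); apply/andP; split.
      by rewrite (le_trans _ xn)// lef_pV2 ?posrE// ler_nat ltnS leq_maxl.
    by rewrite (lt_le_trans xl)// ler_nat (leq_trans (leq_maxr n l))// ltnW// ltnS leq_addl.
  - move=> n; have pn : (0 : R) < (m + n).+1%:R by [].
    apply: (le_trans (hardy_shell mu_ge0 mmu mphi mDphi (growth _) _ pn (lexx _) b0 bE phiE DphiE wg)) => //.
    rewrite lee_fin lerD2l// -/t ler_wpM2l// ler_wpM2l//.
    by rewrite lef_pV2 ?posrE ?exprn_gt0// lerXn2r ?nnegrE// ler_nat ltnS leq_addr.
have qfin : (\int[lambda]_x (q x)%:E)%E \is a fin_num.
  rewrite ge0_fin_numE; last by apply: integral_ge0 => x _; rewrite lee_fin.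
  exact: le_lt_trans (le 0%N) (ltry _).
rewrite -(fineK qfin) -EFinM lee_fin -ler_pdivlMl ?exprn_gt0// mulrC -subr_le0.
apply: (@le0_of_le_harmonic _ (t * nphi)) => n.
have := le n; rewrite -{1}(fineK qfin) lee_fin -lerBlDl => /le_trans; apply.
rewrite mulrA; apply: ler_wpM2l; first exact: mulr_ge0.
rewrite lef_pV2 ?posrE ?exprn_gt0//.
by rewrite ler_eXnr// ler1n.
Qed.

End Exhaustion.

End Limits.

(** * Consequences of the drift bound *)

Section Drift.
Context {R : realType} {N : nat}.
Local Notation lambda := (@lebesgue_rV R N).
Implicit Types (phi mu : 'rV[R]_N -> R) (Dmu Dphi : 'rV[R]_N -> 'rV[R]_N).

Lemma ae_exists (P : 'rV[R]_N -> Prop) : {ae lambda, forall x, P x} -> exists x, P x.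
Proof.
move=> [A [mA A0 PA]]; apply: contrapT => nP.
have cA : @cube R N 1 `<=` A by move=> x _; apply: PA => Px; apply: nP; exists x.
have : lambda (@cube R N 1) = 0%E by exact: subset_measure0 (measurable_cube 1) mA cA A0.
rewrite /cube lebesgue_box => [|i]; last by rewrite ge0_cp.
by move=> [] /eqP; rewrite gt_eqF// prodr_gt0.
Qed.

Lemma ae_weight_gt0 mu : (forall x, 0 <= mu x) -> L1loc (fun x => ((mu x)%:E)^-1)%E ->
  {ae lambda, forall x, 0 < mu x}.
Proof.
move=> mu0 muL.
apply: ae_cubes => k.
have := integrable_ae (@measurable_cube R N k) (L1loc_cube k muL).
apply: filterS => x h xk; rewrite lt_def mu0 andbT; apply/eqP => x0.
by have := h xk; rewrite x0 inve0.
Qed.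

Lemma drift_boundE mu Dmu k1 k2 alpha eps : drift_bound mu Dmu k1 k2 alpha -> 0 < eps ->
  {ae lambda, forall x, alpha * dotv x (Dmu x) <=
    (k1 * (eps + enorm x ^+ 2) + k2 * alpha) * mu x}.
Proof.
move=> drift eps0; apply: filterS (drift eps eps0) => x.
have q0 : 0 < eps + enorm x ^+ 2 by rewrite ltr_wpDr ?sqr_ge0.
rewrite grad_radial_power// dotvZl mulrAC ler_pdivrMr// => /le_trans; apply.
by rewrite le_eqVlt; apply/orP; left; apply/eqP; field; rewrite gt_eqF.
Qed.

(** If [k1 < 0] the bound tends to [-oo] as [eps] tends to [+oo] wherever [mu > 0]. *)
Lemma drift_bound_k1_ge0 mu Dmu k1 k2 alpha : (forall x, 0 <= mu x) ->
  L1loc (fun x => ((mu x)%:E)^-1)%E -> drift_bound mu Dmu k1 k2 alpha -> 0 <= k1.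
Proof.
move=> mu0 muL drift; rewrite leNgt; apply/negP => k10.
have aen : {ae lambda, forall x, forall n, alpha * dotv x (Dmu x) <=
    (k1 * (n.+1%:R + enorm x ^+ 2) + k2 * alpha) * mu x}.
  by apply: ae_foralln => n; exact: drift_boundE.
have [x [h mx]] : exists x, (forall n, alpha * dotv x (Dmu x) <=
    (k1 * (n.+1%:R + enorm x ^+ 2) + k2 * alpha) * mu x) /\ 0 < mu x.
  by apply: ae_exists; apply: filterS2 aen (ae_weight_gt0 mu0 muL).
pose c := alpha * dotv x (Dmu x) - (k1 * enorm x ^+ 2 + k2 * alpha) * mu x.
have km : 0 < - k1 * mu x by rewrite mulr_gt0// oppr_gt0.
have hn n : n.+1%:R * (- k1 * mu x) <= - c by have := h n; rewrite /c; lra.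
have := hn (Num.bound (`|c| / (- k1 * mu x))); rewrite leNgt => /negP; apply.
rewrite (le_lt_trans (ler_norm _))// normrN -ltr_pdivrMr//.
apply: (lt_trans (archi_boundP _)); first by rewrite divr_ge0// ltW.
by rewrite ltr_nat.
Qed.

Lemma drift_bound_eps0 mu Dmu k1 k2 alpha : (forall x, 0 <= mu x) -> 0 <= k1 ->
  drift_bound mu Dmu k1 k2 alpha ->
  {ae lambda, forall x, alpha * dotv x (Dmu x) <= (k1 * enorm x ^+ 2 + k2 * alpha) * mu x}.
Proof.
move=> mu0 k10 drift.
have aen : {ae lambda, forall x, forall n, alpha * dotv x (Dmu x) <=
    (k1 * (n.+1%:R^-1 + enorm x ^+ 2) + k2 * alpha) * mu x}.
  by apply: ae_foralln => n; apply: drift_boundE => //; rewrite invr_gt0.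
apply: filterS aen => x h; rewrite -subr_le0.
apply: (@le0_of_le_harmonic _ _ (k1 * mu x)) => n; rewrite -subr_ge0.
rewrite (_ : _ - _ = (k1 * (n.+1%:R^-1 + enorm x ^+ 2) + k2 * alpha) * mu x -
  alpha * dotv x (Dmu x)); first by rewrite subr_ge0.
ring.
Qed.

Lemma drift_bound_ball mu Dmu k1 k2 alpha r : (forall x, 0 <= mu x) -> 0 <= k1 ->
  alpha < 0 -> drift_bound mu Dmu k1 k2 alpha ->
  {ae lambda, forall y, enorm y < r ->
    (k2 - k1 / (- alpha) * r ^+ 2) * mu y <= dotv y (Dmu y)}.
Proof.
move=> mu0 k10 a0 drift; apply: filterS (drift_bound_eps0 mu0 k10 drift) => y h yr.
have a0' : 0 < - alpha by rewrite oppr_gt0.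
have r0 : 0 <= r by rewrite (le_trans (enorm_ge0 y))// ltW.
have yr2 : enorm y ^+ 2 <= r ^+ 2 by rewrite lerXn2r ?nnegrE ?enorm_ge0// ltW.
have h2 : (k2 - k1 / (- alpha) * enorm y ^+ 2) * mu y <= dotv y (Dmu y).
  rewrite -(ler_pM2l a0').
  rewrite (_ : - alpha * ((k2 - k1 / (- alpha) * enorm y ^+ 2) * mu y) =
    - ((k1 * enorm y ^+ 2 + k2 * alpha) * mu y)); first by move: h; lra.
  by field; rewrite lt_eqF.
apply: le_trans h2; rewrite ler_wpM2r// lerD2l lerN2 ler_wpM2l//.
by rewrite divr_ge0// ltW.
Qed.

(** The term in [k1] disappears as [alpha] tends to [-oo]. *)
Lemma drift_bound_all mu Dmu k1 k2 : (forall x, 0 <= mu x) -> 0 <= k1 ->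
  (forall alpha, alpha < 0 -> drift_bound mu Dmu k1 k2 alpha) ->
  {ae lambda, forall y, k2 * mu y <= dotv y (Dmu y)}.
Proof.
move=> mu0 k10 drift.
have aen : {ae lambda, forall x, forall n, (- n.+1%:R) * dotv x (Dmu x) <=
    (k1 * enorm x ^+ 2 + k2 * (- n.+1%:R)) * mu x}.
  apply: ae_foralln => n; apply: drift_bound_eps0 => //; apply: drift.
  by rewrite oppr_lt0.
apply: filterS aen => x h; rewrite -subr_le0.
apply: (@le0_of_le_harmonic _ _ (k1 * enorm x ^+ 2 * mu x)) => n.
rewrite ler_pdivlMr//; have := h n; lra.
Qed.

Lemma mass_finite mu u : (forall x, 0 <= mu x) -> L2_weight mu u ->
  exists m : R, (\int[lambda]_x (u x ^+ 2 * mu x)%:E = m%:E)%E.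
Proof.
move=> mu0 [mu_ uoo]; exists (fine (\int[lambda]_x (u x ^+ 2 * mu x)%:E)%E).
rewrite fineK// ge0_fin_numE//; apply: integral_ge0 => x _.
by rewrite lee_fin mulr_ge0 ?sqr_ge0.
Qed.

Lemma energy_finite mu Dphi : (forall x, 0 <= mu x) -> measurable_fun setT mu ->
  (forall i, L2_weight mu (fun x => Dphi x ord0 i)) ->
  exists m : R, (\int[lambda]_x (enorm (Dphi x) ^+ 2 * mu x)%:E = m%:E)%E.
Proof.
move=> mu0 mmu DL.
have [m mE] := choice (fun i => mass_finite mu0 (DL i)).
exists (\sum_i m i); rewrite -sumEFin.
under eq_bigr do rewrite -mE.
rewrite -ge0_integral_sum//.
- apply: eq_integral => x _; rewrite sumEFin; congr EFin.
  by rewrite enorm_sqr /dotv mulr_suml; apply: eq_bigr => i _; rewrite expr2.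
- move=> i; apply/measurable_EFinP; apply: measurable_funM => //.
  by apply: measurable_funX; have [] := DL i.
- by move=> i x _; rewrite lee_fin mulr_ge0 ?sqr_ge0.
Qed.

Lemma weighted_Hardy_sharp mu Dmu k1 k2 : (forall x, 0 <= mu x) -> 0 <= k1 ->
  weak_gradient mu Dmu -> 2 - N%:R < k2 ->
  {ae lambda, forall y, k2 * mu y <= dotv y (Dmu y)} ->
  forall c, 0 < c <= Hardy_const (N%:R + k2) -> weighted_Hardy mu k1 c.
Proof.
move=> mu0 k10 wmu k2N mono c /andP[c0 cH] phi Dphi [phiL wphi DphiL].
have mmu : measurable_fun setT mu.
  by have [/L1loc_cube_integrable[]] := wmu.
have [nphi phiE] := mass_finite mu0 phiL.
have [nD DphiE] := energy_finite mu0 mmu DphiL.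
pose b := (N%:R + k2 - 2) / 2.
have b0 : 0 < b by rewrite divr_gt0//; move: k2N; lra.
have bE : N%:R + k2 = 2 * (b + 1) by rewrite /b; field.
have growth r : dilation_growth mu k2 r.
  by move=> s s0; apply: weight_growth wmu s0 _; apply: filterS mono.
have H := hardy_global mu0 mmu phiL.1 (fun i => (DphiL i).1) b0 bE phiE DphiE wphi growth.
rewrite DphiE phiE -EFinM -EFinD.
apply: (@le_trans _ _ nD%:E).
  apply: le_trans H; apply: lee_wpmul2r => //.
  by apply: integral_ge0 => x _; rewrite lee_fin hardy_density_ge0.
rewrite lee_fin lerDl mulr_ge0// -lee_fin -phiE; apply: integral_ge0 => x _.
by rewrite lee_fin mulr_ge0 ?sqr_ge0.
Qed.

(** The radius [r] is chosen so that passing from [k2] to [k] on the ball costs at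
    most half of [N + k2 - 2]; the radius [p = r / e] keeps [e x] in that ball. *)
Lemma weighted_Hardy_single mu Dmu k1 k2 alpha : (forall x, 0 <= mu x) -> 0 < k1 ->
  weak_gradient mu Dmu -> 2 - N%:R < k2 -> alpha < 0 ->
  drift_bound mu Dmu k1 k2 alpha ->
  exists c : R, 0 < c <= Hardy_const (N%:R + k2) /\ weighted_Hardy mu k1 c.
Proof.
move=> mu0 k10 wmu k2N a0 drift.
have mmu : measurable_fun setT mu.
  by have [/L1loc_cube_integrable[]] := wmu.
pose kap := k1 / (- alpha); have kap0 : 0 < kap by rewrite divr_gt0// oppr_gt0.
pose g := N%:R + k2 - 2; have g0 : 0 < g by rewrite /g; move: k2N; lra.
pose r := Num.min 1 (g / (2 * kap)).
have r0 : 0 < r by rewrite lt_min ltr01 divr_gt0// mulr_gt0.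
have kr : kap * r ^+ 2 <= g / 2.
  rewrite (_ : g / 2 = kap * (g / (2 * kap))); last by field; rewrite gt_eqF.
  rewrite ler_wpM2l ?(ltW kap0)// (@le_trans _ _ r)//; last by rewrite ge_min lexx orbT.
  by rewrite expr2 ler_piMr ?(ltW r0)// ge_min lexx.
pose k := k2 - kap * r ^+ 2.
pose b := (N%:R + k - 2) / 2.
have b0 : 0 < b by rewrite divr_gt0// /k; move: kr g0; rewrite /g; lra.
have bE : N%:R + k = 2 * (b + 1) by rewrite /b; field.
have growth : dilation_growth mu k r.
  by move=> s s0; apply: weight_growth wmu s0 _; exact: drift_bound_ball (ltW k10) a0 drift.
pose p := r / expR 1.
have p0 : 0 < p by rewrite divr_gt0// expR_gt0.
have pr : expR 1 * p <= r by rewrite /p mulrC divfK// gt_eqF// expR_gt0.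
pose C1 := (b ^+ 2)^-1.
pose C2 := (expR (- b) / (1 - expR (- b)) + 1) / p ^+ 2.
have C10 : 0 < C1 by rewrite invr_gt0 exprn_gt0.
have C20 : 0 < C2.
  rewrite divr_gt0 ?exprn_gt0// ltr_wpDl// divr_ge0 ?expR_ge0//.
  by rewrite subr_ge0 -expR0 ler_expR oppr_le0 ltW.
have H0 : 0 < Hardy_const (N%:R + k2) by rewrite /Hardy_const exprn_gt0// divr_gt0.
pose c := Num.min (Hardy_const (N%:R + k2)) (Num.min C1^-1 (k1 / C2)).
have c0 : 0 < c by rewrite !lt_min H0 invr_gt0 C10 divr_gt0.
exists c; split; first by rewrite c0 ge_min lexx.
move=> phi Dphi [phiL wphi DphiL].
have [nphi phiE] := mass_finite mu0 phiL.
have [nD DphiE] := energy_finite mu0 mmu DphiL.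
have nphi0 : 0 <= nphi.
  by rewrite -lee_fin -phiE; apply: integral_ge0 => x _; rewrite lee_fin mulr_ge0 ?sqr_ge0.
have nD0 : 0 <= nD.
  by rewrite -lee_fin -DphiE; apply: integral_ge0 => x _; rewrite lee_fin mulr_ge0 ?sqr_ge0.
have H := hardy_near_origin mu0 mmu phiL.1 (fun i => (DphiL i).1) b0 bE phiE DphiE wphi growth p0 pr.
rewrite DphiE phiE -EFinM -EFinD.
apply: (le_trans (lee_wpmul2l _ H)); first by rewrite lee_fin ltW.
rewrite -EFinM lee_fin.
rewrite (_ : nD / b ^+ 2 + _ = C1 * nD + C2 * nphi); last by rewrite /C1 /C2; ring.
rewrite mulrDr (mulrA c C1) (mulrA c C2) lerD//.
  rewrite -[leRHS]mul1r ler_wpM2r// -ler_pdivlMr// mul1r.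
  by rewrite /c !ge_min lexx !orbT.
rewrite ler_wpM2r// -ler_pdivlMr//.
by rewrite /c !ge_min lexx !orbT.
Qed.

End Drift.

Theorem theorem2p4 (R : realType) (N : nat)
    (mu : 'rV[R]_N -> R) (Dmu : 'rV[R]_N -> 'rV[R]_N) (k1 k2 : R)
    (mu_ge0 : forall x, 0 <= mu x)
    (sqrt_mu_H1loc : H1loc (fun x => Num.sqrt (mu x)))
    (Dmu_grad : weak_gradient mu Dmu)
    (Dmu_L1loc : forall i, L1loc (fun x => (Dmu x ord0 i)%:E))
    (inv_mu_L1loc : L1loc (fun x => ((mu x)%:E)^-1)%E)
    (k2_gt : 2 - N%:R < k2) :
  (forall alpha : R, alpha < 0 -> drift_bound mu Dmu k1 k2 alpha ->
    exists c : R, 0 < c <= Hardy_const (N%:R + k2) /\ weighted_Hardy mu k1 c) /\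
  ((forall alpha : R, alpha < 0 -> drift_bound mu Dmu k1 k2 alpha) ->
    forall c : R, 0 < c <= Hardy_const (N%:R + k2) -> weighted_Hardy mu k1 c).
Proof.
split=> [alpha a0 drift|drift].
- have := drift_bound_k1_ge0 mu_ge0 inv_mu_L1loc drift.
  rewrite le_eqVlt => /orP[/eqP k10|k10]; last first.
    exact: weighted_Hardy_single mu_ge0 k10 Dmu_grad k2_gt a0 drift.
  have k1_ge0 : 0 <= k1 by rewrite -k10.
  have H0 : 0 < Hardy_const (N%:R + k2).
    by rewrite exprn_gt0// divr_gt0//; move: k2_gt; lra.
  exists (Hardy_const (N%:R + k2)); split; first by rewrite H0 lexx.
  apply: (weighted_Hardy_sharp mu_ge0 k1_ge0 Dmu_grad k2_gt); last by rewrite H0 lexx.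
  apply: filterS (drift_bound_eps0 mu_ge0 k1_ge0 drift) => y.
  rewrite -k10 mul0r add0r => h.
  by rewrite -(ler_nM2l a0); apply: le_trans h _; rewrite le_eqVlt; apply/orP; left; apply/eqP; ring.
- have k1_ge0 := drift_bound_k1_ge0 mu_ge0 inv_mu_L1loc (drift _ (ltrN10 R)).
  exact: weighted_Hardy_sharp mu_ge0 k1_ge0 Dmu_grad k2_gt (drift_bound_all mu_ge0 k1_ge0 drift).
Qed.
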